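(* Let $p\ge2$, $1<q<\infty$, and let $H=\tilde H_q$, i.e. $$H(z)=\left(F^q(Z_1)+G^q(Z_2)\right)^{1/q},\qquad z=(Z_1,Z_2)\in\mathbb{R}^m\times\mathbb{R}^{n-m},$$ with $F:\mathbb{R}^m\to\mathbb{R}$ and $G:\mathbb{R}^{n-m}\to\mathbb{R}$ as in the context. Let $$\lambda^1_\ell=\min_{v\in W^{1,p}_0(\Omega_\ell),\,v\ne0}\frac{\int_{\Omega_\ell}H^p(\nabla v)\,dx}{\int_{\Omega_\ell}|v|^p\,dx},\qquad \mu_\infty=\min_{w\in W^{1,p}_0(\omega_2),\,w\neq0}\frac{\int_{\omega_2}H^p(\nabla_2w)\,dX_2}{\int_{\omega_2}|w|^p\,dX_2}.$$ If $q\le p$, then $$\frac{C_1}{\ell^p}+\mu_\infty\le\lambda^1_\ell ,$$ and if $q\ge p$, then $$\lambda^1_\ell\le\mu_\infty+\frac{C_2}{\ell^p},$$ where $C_1=C_1(\theta_1,p)$ and $C_2=C_2(\theta_2,m,p)$ are positive constants, depending only on the quantities indicated.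
   Context: Let $1\le m<n$, let $\omega_1\subset\mathbb{R}^m$ be open, bounded and convex with $0\in\omega_1$, and let $\omega_2\subset\mathbb{R}^{n-m}$ be open and bounded. For $\ell>0$ set $\Omega_\ell=\ell\omega_1\times\omega_2\subset\mathbb{R}^n$. Points are written $x=(X_1,X_2)$ with $X_1\in\mathbb{R}^m$, $X_2\in\mathbb{R}^{n-m}$, and $\nabla_2:=(0,\dots,0,\partial_{x_{m+1}},\dots,\partial_{x_n})\in\mathbb{R}^n$. Standing assumptions on $H:\mathbb{R}^n\to[0,+\infty)$: $H(x)>0$ for $x\ne0$; $H$ is convex; $H(tx)=|t|H(x)$ for all $t\in\mathbb{R}$, $x\in\mathbb{R}^n$; $H\in C^1(\mathbb{R}^n\setminus\{0\})$; and (for $p\ge2$) there is a constant $c_1>0$ such that for all $z_1,z_2\in\mathbb{R}^n$ $$\langle H^{p-1}(z_1)\nabla H(z_1)-H^{p-1}(z_2)\nabla H(z_2),\,z_1-z_2\rangle\ge c_1|z_1-z_2|^p.$$ Put $\theta_1=\min_{|x|=1}H(x)$ and $\theta_2=\max_{|x|=1}H(x)$. The functions $F$ and $G$ satisfy, for all $Z_1,W_1\in\mathbb{R}^m$ and $Z_2,W_2\in\mathbb{R}^{n-m}$, $$\langle F^{p-1}(Z_1)\nabla F(Z_1)-F^{p-1}(W_1)\nabla F(W_1),\,Z_1-W_1\rangle\ge c_1|Z_1-W_1|^p,$$ $$\langle G^{p-1}(Z_2)\nabla G(Z_2)-G^{p-1}(W_2)\nabla G(W_2),\,Z_2-W_2\rangle\ge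 c_1|Z_2-W_2|^p,$$ $$\theta_1|Z_1|\le F(Z_1)\le\theta_2|Z_1|,\qquad\theta_1|Z_2|\le G(Z_2)\le\theta_2|Z_2|.$$ The fields $H^{p-1}\nabla H$, $F^{p-1}\nabla F$ and $G^{p-1}\nabla G$ are understood to be $0$ at the origin.
   Formalization: The constants C_1 and C_2 are allowed to depend also on the fixed set ω_1 (hence on m): replacing ω_1 by rω_1 amounts to replacing ℓ by rℓ, so no positive constants independent of ω_1 can exist. *)

(* Defs.v *)
From HB Require Import structures.
From mathcomp Require Import all_boot all_order all_algebra.
From mathcomp Require Import all_classical all_reals all_analysis.
Set Implicit Arguments.
Unset Strict Implicit.
Unset Printing Implicit Defensive.
Import Order.TTheory GRing.Theory Num.Theory.
Import numFieldNormedType.Exports.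
Local Open Scope classical_set_scope.
Local Open Scope ring_scope.

Definition measure_rV_display : measure_display -> measure_display.
Proof. exact. Qed.

(* The product sigma-algebra on row vectors, generated by the coordinates (for
   entries in R this is the Borel sigma-algebra), as the library does for
   tuples. *)
Section measurable_rV.
Context {d} {T : sigmaRingType d}.
Variable n : nat.

Let coor (i : 'I_n) (x : 'rV[T]_n) : T := x ord0 i.

Let rV_set0 : g_sigma_preimage coor set0.
Proof. exact: sigma_algebra0. Qed.

Let rV_setC A : g_sigma_preimage coor A -> g_sigma_preimage coor (~` A).
Proof. exact: sigma_algebraC. Qed.

Let rV_bigcup (F : _^nat) : (forall i, g_sigma_preimage coor (F i)) ->
  g_sigma_preimage coor (\bigcup_i (F i)).
Proof. exact: sigma_algebra_bigcup. Qed.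

HB.instance Definition _ := @isMeasurable.Build (measure_rV_display d)
  'rV[T]_n (g_sigma_preimage coor) rV_set0 rV_setC rV_bigcup.

End measurable_rV.

Section measurable_rV_fun.
Context {R : realType}.

Lemma measurable_coord n (i : 'I_n) :
  measurable_fun [set: 'rV[R]_n] (fun x : 'rV[R]_n => x ord0 i).
Proof.
move=> _ Y mY; rewrite setTI; apply: sub_sigma_algebra => /=.
rewrite -bigcup_seq/=; exists i => /=; first by rewrite mem_index_enum.
by exists Y => //; rewrite setTI.
Qed.

Lemma measurable_fun_rV d (T : measurableType d) n (f : T -> 'rV[R]_n) :
  (forall i, measurable_fun [set: T] (fun x => f x ord0 i)) ->
  measurable_fun [set: T] f.
Proof.
move=> mf _.
suff: (g_sigma_preimage (fun (i : 'I_n) (x : 'rV[R]_n) => x ord0 i)) `<=`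
    [set A | measurable (f @^-1` A)].
  by move=> + A mA => /(_ A mA); rewrite setTI.
apply: smallest_sub.
  split => [|A mA|F mF] /=.
  - by rewrite preimage_set0.
  - by rewrite setTD preimage_setC; exact: measurableC.
  - by rewrite preimage_bigcup; exact: bigcupT_measurable.
move=> A; rewrite -bigcup_seq => -[i _ [B mB <-]] /=.
by have := mf i measurableT B mB; rewrite !setTI.
Qed.

End measurable_rV_fun.

Section lebesgue_rV.
Context {R : realType}.
Local Open Scope ereal_scope.

Definition cons_rV n (tv : measurableTypeR R * 'rV[R]_n) : 'rV[R]_n.+1 :=
  \row_i oapp (tv.2 ord0) tv.1 (unlift ord0 i).

Definition uncons_rV n (x : 'rV[R]_n.+1) : measurableTypeR R * 'rV[R]_n :=
  (x ord0 ord0, \row_i x ord0 (lift ord0 i)).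

Lemma cons_rVK n : cancel (@cons_rV n) (@uncons_rV n).
Proof.
move=> [t v]; rewrite /uncons_rV /cons_rV mxE unlift_none /=; congr pair.
by apply/rowP => i; rewrite !mxE liftK.
Qed.

Lemma measurable_cons_rV n : measurable_fun [set: _] (@cons_rV n).
Proof.
apply: measurable_fun_rV => i; under eq_fun do rewrite mxE.
case: unliftP => [j|] _ /=; last exact: measurable_fst.
exact: (measurableT_comp (measurable_coord j) measurable_snd).
Qed.

Lemma measurable_uncons_rV n : measurable_fun [set: _] (@uncons_rV n).
Proof.
apply/measurable_fun_pairP; split; first exact: measurable_coord.
apply: measurable_fun_rV => i /=; under eq_fun do rewrite mxE.
exact: measurable_coord.
Qed.

HB.instance Definition _ n := @isMeasurableFun.Build _ _ _ _ (@cons_rV n)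
  (@measurable_cons_rV n).

Section lebesgue_step.
Variables (n : nat) (mu : {sigma_finite_measure set 'rV[R]_n -> \bar R}).

Definition lebesgue_step : set 'rV[R]_n.+1 -> \bar R :=
  pushforward (lebesgue_measure \x mu) (@cons_rV n).

Let step0 : lebesgue_step set0 = 0. Proof. exact: measure0. Qed.

Let step_ge0 A : 0 <= lebesgue_step A. Proof. exact: measure_ge0. Qed.

Let step_sigma_additive : semi_sigma_additive lebesgue_step.
Proof. exact: measure_semi_sigma_additive. Qed.

HB.instance Definition _ := isMeasure.Build _ _ _ lebesgue_step
  step0 step_ge0 step_sigma_additive.

Let step_sigma_finite : sigma_finite setT lebesgue_step.
Proof.
have /sigma_finiteP[A [AT ndA Aoo]] := sigma_finiteT (@lebesgue_measure R).
have /sigma_finiteP[B [BT ndB Boo]] := sigma_finiteT mu.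
exists (fun i => @uncons_rV n @^-1` (A i `*` B i)) => [|i].
  apply/esym/seteqP; split=> // x _.
  have [i _ Ai] : (\bigcup_i A i) (uncons_rV x).1 by rewrite -AT.
  have [j _ Bj] : (\bigcup_i B i) (uncons_rV x).2 by rewrite -BT.
  exists (maxn i j) => //; split.
  - by move: Ai; exact/subsetPset/ndA/leq_maxl.
  - by move: Bj; exact/subsetPset/ndB/leq_maxr.
have [mA Aioo] := Aoo i; have [mB Bioo] := Boo i; split.
  rewrite -[X in measurable X]setTI.
  by apply: measurable_uncons_rV => //; exact: measurableX.
rewrite /lebesgue_step /pushforward -comp_preimage.
rewrite (_ : _ \o _ = id); last by apply/funext => x /=; rewrite cons_rVK.
by rewrite preimage_id product_measure1E// lte_mul_pinfty// ge0_fin_numE.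
Qed.

HB.instance Definition _ := Measure_isSigmaFinite.Build _ _ _ lebesgue_step
  step_sigma_finite.

End lebesgue_step.

(* Lebesgue measure on R^n, as the n-fold product of the one on R. *)
Fixpoint lebesgue_rV n : {sigma_finite_measure set 'rV[R]_n -> \bar R} :=
  if n is n'.+1 then lebesgue_step (lebesgue_rV n') else
    @dirac _ 'rV[R]_0 0%R R.

End lebesgue_rV.
Arguments lebesgue_rV {R} n.

(* The norm of the library on row vectors is the maximum norm, so the Euclidean
   structure is spelled out. *)
Section euclidean.
Context {R : realType} {n : nat}.
Implicit Types (x y : 'rV[R]_n) (f : 'rV[R]_n -> R).

Definition dotp x y : R := \sum_i x ord0 i * y ord0 i.

Definition enorm x : R := Num.sqrt (dotp x x).

Definition unit_sphere : set 'rV[R]_n := [set x | enorm x = 1].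

Definition partial (i : 'I_n) f : 'rV[R]_n -> R := 'D_(delta_mx ord0 i) f.

Definition grad f x : 'rV[R]_n := \row_i partial i f x.

Definition C1_off0 f := forall x, x != 0 -> forall i,
  derivable f x (delta_mx ord0 i) /\ {for x, continuous (partial i f)}.

(* Class C^oo: all iterated partial derivatives exist and are continuous. *)
Definition smooth f := forall s : seq 'I_n,
  continuous (foldr partial f s) /\
  forall i x, derivable (foldr partial f s) x (delta_mx ord0 i).

End euclidean.

Section sobolev.
Context {R : realType} {n : nat}.
Implicit Types (Omega : set 'rV[R]_n) (u v phi : 'rV[R]_n -> R)
  (g : 'rV[R]_n -> 'rV[R]_n) (p : R).
Local Notation mu := (lebesgue_rV n).

(* C_c^oo(Omega), its elements being extended by 0 to the whole space. *)
Definition test_fun Omega phi :=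
  let supp := closure [set x | phi x != 0] in
  [/\ smooth phi, compact supp & supp `<=` Omega].

Definition Lp Omega p u : Prop := u \_ Omega \in Lfun mu p%:E.

Definition Lp_norm Omega p u : \bar R := 'N[mu]_(p%:E)[EFin \o u \_ Omega].

Definition weak_gradient Omega u g := forall phi, test_fun Omega phi ->
  forall i, \int[mu]_(x in Omega) (u x * partial i phi x) =
          - \int[mu]_(x in Omega) (g x ord0 i * phi x).

(* [sobolev Omega p u g]: u belongs to W^{1,p}(Omega) and g is (a representative
   of) its weak gradient, which is unique up to a null set. *)
Definition sobolev Omega p u g :=
  [/\ Lp Omega p u, forall i, Lp Omega p (fun x => g x ord0 i)
    & weak_gradient Omega u g].

Definition sobolev_norm Omega p u g : \bar R :=
  (Lp_norm Omega p u + \sum_i Lp_norm Omega p (fun x => g x ord0 i))%E.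

(* W_0^{1,p}(Omega): the closure of C_c^oo(Omega) in W^{1,p}(Omega). *)
Definition sobolev0 Omega p u g :=
  sobolev Omega p u g /\
  forall e : R, 0 < e -> exists2 phi, test_fun Omega phi &
    (sobolev_norm Omega p (u \- phi)%R (fun x => g x - grad phi x)%R < e%:E)%E.

Definition rayleigh_quotient Omega p (K : 'rV[R]_n -> R) v g : \bar R :=
  ((\int[mu]_(x in Omega) (K (g x) `^ p)%:E) /
   (\int[mu]_(x in Omega) (`|v x| `^ p)%:E))%E.

Definition rayleigh_quotients Omega p (K : 'rV[R]_n -> R) : set (\bar R) :=
  [set l | exists v g, [/\ sobolev0 Omega p v g,
     ~ (v = cst 0 %[ae mu in Omega]) & l = rayleigh_quotient Omega p K v g]].

(* The minimum of the quotients, taken as an infimum so that its being attained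
   is not assumed: it is the minimum as soon as there is one, by
   [rayleigh_inf_min] below. *)
Definition rayleigh_inf Omega p K : \bar R :=
  ereal_inf (rayleigh_quotients Omega p K).

End sobolev.

Definition is_minimum d (T : porderType d) (A : set T) a := A a /\ lbound A a.
Definition is_maximum d (T : porderType d) (A : set T) a := A a /\ ubound A a.

Lemma rayleigh_inf_min (R : realType) n (Omega : set 'rV[R]_n) p K l :
  is_minimum (rayleigh_quotients Omega p K) l -> rayleigh_inf Omega p K = l.
Proof.
move=> [Al Ll]; apply/eqP; rewrite eq_le; apply/andP; split.
  exact: ereal_inf_lbound.
exact: le_ereal_inf_tmp.
Qed.

Section finsler.
Context {R : realType}.

Record finsler n (H : 'rV[R]_n -> R) : Prop := Finsler {
  finsler_ge0 : forall x, 0 <= H x ;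
  finsler_gt0 : forall x, x != 0 -> 0 < H x ;
  finsler_convex : @convex_function R 'rV[R]_n setT H ;
  finsler_homo : forall (t : R) x, H (t *: x) = `|t| * H x ;
  finsler_C1 : C1_off0 H }.

Definition flux n (p : R) (F : 'rV[R]_n -> R) z : 'rV[R]_n :=
  if z == 0 then 0 else F z `^ (p - 1) *: grad F z.

Definition strongly_monotone n (p c : R) (F : 'rV[R]_n -> R) := forall z w,
  c * enorm (z - w) `^ p <= dotp (flux p F z - flux p F w) (z - w).

Definition norm_bounds n (theta1 theta2 : R) (F : 'rV[R]_n -> R) := forall z,
  theta1 * enorm z <= F z <= theta2 * enorm z.

Definition Htilde m k (q : R) (F : 'rV[R]_m -> R) (G : 'rV[R]_k -> R)
    (z : 'rV[R]_(m + k)) : R :=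
  (F (lsubmx z) `^ q + G (rsubmx z) `^ q) `^ q^-1.

Definition cylinder m k (l : R) (omega1 : set 'rV[R]_m)
    (omega2 : set 'rV[R]_k) : set 'rV[R]_(m + k) :=
  [set x | [set l *: y | y in omega1] (lsubmx x) /\ omega2 (rsubmx x)].

End finsler.

(* Main.v *)
Require Import Defs.
From HB Require Import structures.
From mathcomp Require Import all_boot all_order all_algebra.
From mathcomp Require Import all_classical all_reals all_analysis.
From mathcomp Require Import measurable_realfun ring lra.
Set Implicit Arguments.
Unset Strict Implicit.
Unset Printing Implicit Defensive.
Import Order.TTheory GRing.Theory Num.Theory.
Import numFieldNormedType.Exports.
Local Open Scope classical_set_scope.
Local Open Scope ring_scope.

(* By density of the test functions and Minkowski's inequality, a real [A >= 0]
   is at most the infimum of the Rayleigh quotients of [K] if and only if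
   [A * \int |phi|^p <= \int K(grad phi)^p] for every test function [phi]; so
   both estimates only have to be checked on test functions.

   If [q <= p], then [H^p >= F^p + G^p]. Fubini's theorem, applied to the slices
   [phi(X1, .)], which are test functions on [omega2], bounds the integral of
   [G^p] below by [mu \int |phi|^p]; the integral of [F^p] dominates
   [theta1^p \int |d_1 phi|^p], which the Poincare inequality along the first
   coordinate bounds below by [C1 / l^p \int |phi|^p].

   If [p <= q], then [H^p <= F^p + G^p], and one tests with
   [rho(X1 / l) phi(X2)], where [rho] is a fixed bump function on [omega1]. *)

(** * Smooth functions on row vectors *)

(** The infima are not known to be attained, so no eigenfunction is at hand: the lower bound is
    checked on every test function of the cylinder, the upper bound on products built from an
    arbitrary [phi] on [omega2]. An infimum may also be [+oo], when no function is admissible;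
    [le_ereal_real] reduces both claims to real lower bounds. With [r = p / q],
    [H^p = (F^q + G^q)^r], and the two regimes are super- and subadditivity of [t^r] for [r >= 1]
    and [r <= 1]. The constants depend on [omega1], [theta] and [p], and are fixed before [q],
    [omega2], [F] and [G]. If [omega1] lies in [|x_i| < M], the Poincare constant along the first
    axis of the cylinder is [(2 l M)^p], whence [C1 = (theta1 / (2 M))^p]. For the bump [rho],
    [C2 = theta2^p (b + 1) / a], with [a] and [b] the integrals of [|rho|^p] and
    [(\sum_i |d_i rho|)^p]; the [+ 1] makes [C2 > 0] immediate. Smoothness is stated by iterated
    partial derivatives and Lebesgue measure by recursion on the dimension; so derivatives are taken
    along coordinate lines and integrals one coordinate at a time. *)

Section smooth_calculus.
Context {R : realType}.

Lemma rV_continuous (T : topologicalType) n (f : T -> 'rV[R]_n) :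
  (forall i, continuous (fun x => f x ord0 i)) -> continuous f.
Proof.
move=> cf x /= V /nbhs_ballP [e /= e0 eV].
have : \forall y \near x, forall i, `|f x ord0 i - f y ord0 i| < e.
  by apply: filter_forall => i; have /cvgrPdist_lt/(_ _ e0) := cf i x.
by apply: filterS => y xy; apply: eV; split=> // a i; rewrite (ord1 a); exact: xy.
Qed.

(** This turns a directional derivative into a derivative in one real variable, to which the
    one-variable chain rule applies. *)
Lemma is_derive_lineP n (f : 'rV[R]_n -> R) x v (d : R) :
  is_derive x v f d <-> is_derive (0 : R) (1 : R) (fun h : R => f (h *: v + x)) d.
Proof.
have E : 'D_v f x = 'D_1 (fun h : R => f (h *: v + x)) 0.
  rewrite /derive; set g1 := fun h => h^-1 *: _; set g2 := fun h => h^-1 *: _.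
  suff -> : g1 = g2 by [].
  apply/funext => h; rewrite /g1 /g2 /=.
  by rewrite addr0 scale0r add0r [_%:A]mulr1.
split=> -[df D].
  apply: DeriveDef; last by rewrite -E.
  by have /derivable1P := df.
apply: DeriveDef; last by rewrite E.
by apply/derivable1P.
Qed.

(** [A] maps the line through [x] affinely onto a line with direction [w] and speed [c], so only the
    derivative of [f] along [w] enters, not its total derivative. *)
Lemma is_derive_comp_dir n n' (A : 'rV[R]_n -> 'rV[R]_n') (f : 'rV[R]_n' -> R)
    x v w c d :
  (forall h : R, A (h *: v + x) = (h * c) *: w + A x) ->
  is_derive (A x) w f d -> is_derive x v (f \o A) (c * d).
Proof.
move=> Av /is_derive_lineP fd; apply/is_derive_lineP.
have -> : (fun h : R => (f \o A) (h *: v + x)) =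
    (fun h : R => f (h *: w + A x)) \o (fun h => h * c).
  by apply/funext => h /=; rewrite Av.
have -> : c * d = d * c by rewrite mulrC.
have i2 : is_derive (0 : R) (1 : R) (fun h : R => h * c) c.
  have := @is_deriveM _ _ id (cst c) (0 : R) (1 : R) 1 0 _ _.
  by rewrite scaler0 add0r [c *: 1]mulr1; apply.
have := @is_derive1_comp R (fun h : R => f (h *: w + A x)) (fun h => h * c) 0 d c.
by apply => //; rewrite mul0r.
Qed.

(** Class C^N by recursion on the order, the form in which closure under sums, products and
    compositions goes by induction; [smoothP] links it to [smooth]. *)
Fixpoint smooth_upto N n (f : 'rV[R]_n -> R) : Prop :=
  continuous f /\ if N is N'.+1 then
    forall i, (forall x, derivable f x (delta_mx ord0 i)) /\
      smooth_upto N' (partial i f)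
  else True.

Lemma smooth_upto_continuous N n (f : 'rV[R]_n -> R) :
  smooth_upto N f -> continuous f.
Proof. by case: N => [|N] []. Qed.
Arguments smooth_upto_continuous {N n f}.

Lemma smooth_partial n (f : 'rV[R]_n -> R) i : smooth f -> smooth (partial i f).
Proof. by move=> sf s; have := sf (rcons s i); rewrite foldr_rcons. Qed.

Lemma smooth_continuous n (f : 'rV[R]_n -> R) : smooth f -> continuous f.
Proof. by move=> /(_ [::])[]. Qed.
Arguments smooth_continuous {n f}.

Lemma smooth_derivable n (f : 'rV[R]_n -> R) i x :
  smooth f -> derivable f x (delta_mx ord0 i).
Proof. by move=> /(_ [::])[_ /(_ i x)]. Qed.

Lemma is_derive_partial n (f : 'rV[R]_n -> R) i x :
  smooth f -> is_derive x (delta_mx ord0 i) f (partial i f x).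
Proof. by move=> /smooth_derivable - /(_ i x) /derivableP. Qed.

Lemma smoothP n (f : 'rV[R]_n -> R) : smooth f <-> forall N, smooth_upto N f.
Proof.
split=> [sf N|].
  elim: N f sf => [|N IH] f sf /=; split=> //; try exact: smooth_continuous.
  by move=> i; split=> [x|]; [exact: smooth_derivable | exact/IH/smooth_partial].
(* [foldr] differentiates along the last entry of [s] before the others, hence the induction from
   the end. *)
move=> + s; elim/last_ind: s f => [|s i IH] f sf.
  split=> /=; first by case: (sf 0%N).
  by move=> i x; have [_ /(_ i)[]] := sf 1%N.
rewrite foldr_rcons; apply: IH => N.
by have [_ /(_ i)[]] := sf N.+1.
Qed.

Lemma smooth_uptoW N n (f : 'rV[R]_n -> R) : smooth_upto N.+1 f -> smooth_upto N f.
Proof.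
elim: N f => [|N IH] f; first by case.
move=> [cf df]; split=> // i; have [dif sf] := df i; split=> //.
exact: IH.
Qed.

Lemma smooth_uptoS N n (f : 'rV[R]_n -> R) (g : 'I_n -> 'rV[R]_n -> R) :
  continuous f ->
  (forall i x, is_derive x (delta_mx ord0 i) f (g i x)) ->
  (forall i, smooth_upto N (g i)) -> smooth_upto N.+1 f.
Proof.
move=> cf fg sg; split=> // i; split=> [x|]; first by case: (fg i x).
suff -> : partial i f = g i by [].
by apply/funext => x; case: (fg i x).
Qed.

Lemma smooth_upto_is_derive N n (f : 'rV[R]_n -> R) i x :
  smooth_upto N.+1 f -> is_derive x (delta_mx ord0 i) f (partial i f x).
Proof. by move=> [_ /(_ i)[/(_ x) /derivableP]]. Qed.

Lemma smooth_upto_cst N n (a : R) : smooth_upto N (fun=> a : R) (n := n).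
Proof.
elim: N a => [|N IH] a /=; first by split=> //; exact: cst_continuous.
split; first exact: cst_continuous.
move=> i; split=> [x|]; first exact: derivable_cst.
suff -> : partial i (fun=> a : R) (n := n) = fun=> 0 by exact: IH.
by apply/funext => x; rewrite /partial derive_cst.
Qed.

Lemma smooth_uptoD N n (f g : 'rV[R]_n -> R) :
  smooth_upto N f -> smooth_upto N g -> smooth_upto N (fun x => f x + g x).
Proof.
elim: N f g => [|N IH] f g sf sg.
  by split=> // x; exact: (continuousD (smooth_upto_continuous sf x) (smooth_upto_continuous sg x)).
apply: (@smooth_uptoS _ _ _ (fun i x => partial i f x + partial i g x)).
- by move=> x; exact: (continuousD (smooth_upto_continuous sf x) (smooth_upto_continuous sg x)).
- move=> i x.
  exact: (is_deriveD (smooth_upto_is_derive i x sf) (smooth_upto_is_derive i x sg)).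
- by move=> i; apply: IH; [exact: (sf.2 i).2 | exact: (sg.2 i).2].
Qed.

Lemma smooth_uptoM N n (f g : 'rV[R]_n -> R) :
  smooth_upto N f -> smooth_upto N g -> smooth_upto N (fun x => f x * g x).
Proof.
elim: N f g => [|N IH] f g sf sg.
  by split=> // x; exact: (continuousM (smooth_upto_continuous sf x) (smooth_upto_continuous sg x)).
apply: (@smooth_uptoS _ _ _ (fun i x => f x * partial i g x + g x * partial i f x)).
- by move=> x; exact: (continuousM (smooth_upto_continuous sf x) (smooth_upto_continuous sg x)).
- move=> i x.
  exact: (is_deriveM (smooth_upto_is_derive i x sf) (smooth_upto_is_derive i x sg)).
- move=> i; apply: smooth_uptoD; apply: IH; try exact: smooth_uptoW.
  + exact: (sg.2 i).2.
  + exact: (sf.2 i).2.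
Qed.

Lemma smoothM n (f g : 'rV[R]_n -> R) :
  smooth f -> smooth g -> smooth (fun x => f x * g x).
Proof. by move=> /smoothP sf /smoothP sg; apply/smoothP => N; exact: smooth_uptoM. Qed.

Lemma smooth_prod n (I : Type) (s : seq I) (f : I -> 'rV[R]_n -> R) :
  (forall i, smooth (f i)) -> smooth (fun x => \prod_(i <- s) f i x).
Proof.
move=> sf; elim: s => [|i s IH].
  under eq_fun do rewrite big_nil.
  by apply/smoothP => N; exact: smooth_upto_cst.
under eq_fun do rewrite big_cons.
exact: (smoothM (sf i) IH).
Qed.

(* Such maps send coordinate lines to coordinate lines or to points, so that
   composing with them only takes the chain rule in one variable. *)
Definition coordinatewise n n' (A : 'rV[R]_n -> 'rV[R]_n') :=
  forall i, (exists c j, forall (h : R) x,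
      A (h *: delta_mx ord0 i + x) = (h * c) *: delta_mx ord0 j + A x) \/
    (forall (h : R) x, A (h *: delta_mx ord0 i + x) = A x).

(** Each partial derivative of [f \o A] is either [0] or [c] times [partial j f \o A], which has the
    same shape with one order less. *)
Lemma smooth_comp n n' (A : 'rV[R]_n -> 'rV[R]_n') (f : 'rV[R]_n' -> R) :
  continuous A -> coordinatewise A -> smooth f -> smooth (fun x => f (A x)).
Proof.
move=> cA hA /smoothP sf; apply/smoothP => N.
elim: N f {sf}(sf N) => [|N IH] f sf.
  by split=> // x; exact: (continuous_comp (cA x) (smooth_upto_continuous sf (A x))).
split=> [x|i].
  exact: (continuous_comp (cA x) (smooth_upto_continuous sf (A x))).
have [[c [j Aj]]|A0] := hA i.
  have D x : is_derive x (delta_mx ord0 i) (f \o A) (c * partial j f (A x)).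
    by apply: (is_derive_comp_dir (Aj ^~ x)); exact: (smooth_upto_is_derive j (A x) sf).
  split=> [x|]; first by case: (D x).
  have -> : partial i (fun x => f (A x)) = fun x => c * partial j f (A x).
    by apply/funext => x; case: (D x).
  apply: smooth_uptoM; first exact: smooth_upto_cst.
  by apply: (IH (partial j f)); exact: (sf.2 j).2.
have D x : is_derive x (delta_mx ord0 i) (f \o A) (0 * 0).
  (* Direction [0] lets the chain rule cover a line on which [A] is constant. *)
  apply: (@is_derive_comp_dir _ _ _ _ _ _ 0).
    by move=> h; rewrite A0 scaler0 add0r.
  exact: is_derive0.
split=> [x|]; first by case: (D x).
have -> : partial i (fun x => f (A x)) = fun x => 0.
  by apply/funext => x; have [_] := D x; rewrite mulr0.
exact: smooth_upto_cst.
Qed.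

Lemma partial_comp_dir n n' (A : 'rV[R]_n -> 'rV[R]_n') (f : 'rV[R]_n' -> R)
    i j c x :
  (forall h, A (h *: delta_mx ord0 i + x) = (h * c) *: delta_mx ord0 j + A x) ->
  smooth f -> partial i (fun x => f (A x)) x = c * partial j f (A x).
Proof.
move=> Aj sf; have [//] := is_derive_comp_dir Aj (is_derive_partial j (A x) sf).
Qed.

Lemma partial_comp_dir0 n n' (A : 'rV[R]_n -> 'rV[R]_n') (f : 'rV[R]_n' -> R) i x :
  (forall h, A (h *: delta_mx ord0 i + x) = A x) ->
  partial i (fun x => f (A x)) x = 0.
Proof.
move=> A0.
have Aj (h : R) : A (h *: delta_mx ord0 i + x) = (h * 0) *: 0 + A x.
  by rewrite A0 scaler0 add0r.
by have [_] := is_derive_comp_dir Aj (is_derive0 f (A x)); rewrite mulr0.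
Qed.

Lemma partialM n (f g : 'rV[R]_n -> R) i x : smooth f -> smooth g ->
  partial i (fun x => f x * g x) x = f x * partial i g x + g x * partial i f x.
Proof.
move=> sf sg.
have [//] := is_deriveM (is_derive_partial i x sf) (is_derive_partial i x sg).
Qed.

(* The family is closed under differentiation, see [is_derive_flat]: this is what
   makes [exp(-1/x)], extended by [0], smooth. *)
Definition flat (p : {poly R}) (x : R) : R :=
  if 0 < x then p.[x^-1] * expR (- x^-1) else 0.

(** With [y = 1/x], the inequality [exp y >= y^(i+1) / (i+1)!] gives [y^i exp(-y) <= (i+1)! x] for
    each monomial. The bound is linear in [x] so that it forces limit [0] at the origin. *)
Lemma flat_bound p : exists C, forall x, `|flat p x| <= C * `|x|.
Proof.
exists (\sum_(i < size p) `|p`_i| * (i.+1)`!%:R) => x.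
rewrite /flat; case: ifPn => [x0|_]; last first.
  by rewrite normr0 mulr_ge0// sumr_ge0// => i _; rewrite mulr_ge0.
rewrite horner_coef (gtr0_norm x0) !mulr_suml.
apply: (le_trans (ler_norm_sum _ _ _)); apply: ler_sum => i _.
have y0 : 0 < x^-1 by rewrite invr_gt0.
rewrite !normrM -!mulrA ler_wpM2l// gtr0_norm ?exprn_gt0//.
rewrite gtr0_norm ?expR_gt0// expRN ler_pdivrMr ?expR_gt0//.
have := expR_ge1Dxn i (ltW y0); set e := expR _ => he.
have f0 : 0 < (i.+1)`!%:R :> R by rewrite ltr0n fact_gt0.
have {}he : x^-1 ^+ i.+1 <= e * (i.+1)`!%:R.
  by rewrite -ler_pdivrMr//; apply: le_trans he; rewrite lerDr.
have := ler_wpM2l (ltW x0) he; rewrite exprS mulrA divff ?gt_eqF// mul1r.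
by move=> /le_trans; apply; rewrite (mulrC e) mulrA (mulrC x).
Qed.

(** For [x > 0], the product rule applied to [p(1/x) exp(-1/x)] brings out [x^-2 (p - p')(1/x)]. At
    [0] the difference quotient of [flat p] is [flat ('X * p)], which tends to [0] by
    [flat_bound]. *)
Lemma is_derive_flat p (x : R) :
  is_derive x (1 : R) (flat p) (flat ('X^2 * (p - p^`())) x).
Proof.
have [x0|x0|->] := ltgtP x 0.
- have E : {near x, cst 0 =1 flat p}.
    near=> y; rewrite /flat ifF//; apply/negbTE; rewrite -leNgt ltW//.
    by near: y; exact: lt_nbhsl.
  rewrite /flat [X in is_derive _ _ _ X]ifF; last by rewrite lt_gtF.
  by apply: near_eq_is_derive E _; exact: is_derive_cst.
- have E : {near x, (fun y => (p.[y^-1] * expR (- y^-1))) =1 flat p}.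
    near=> y; rewrite /flat ifT//.
    by near: y; exact: lt_nbhsr.
  apply: near_eq_is_derive E _.
  have xn : x != 0 by rewrite gt_eqF.
  have dV : is_derive x (1:R) (fun y : R => y^-1) (- x ^- 2).
    have := @is_deriveV R (fun y => y) x 1 1 xn _.
    by move=> /(_ (is_derive_id _ _)); rewrite [_ *: 1]mulr1.
  have dp : is_derive x (1:R) ((fun y => p.[y]) \o (fun y : R => y^-1)) (p^`().[x^-1] * - x ^- 2).
    have dpx : is_derive x^-1 (1 : R) (horner p) p^`().[x^-1].
      by apply: DeriveDef; rewrite -?derive1E ?derivE//; exact: derivable_horner.
    exact: is_derive1_comp.
  have de : is_derive x (1:R) (expR \o (fun y : R => - y^-1)) (expR (- x^-1) * - - x ^- 2).
    exact: is_derive1_comp.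
  apply: (is_derive_eq (is_deriveM dp de)).
  rewrite /flat x0 /= !hornerE /= /GRing.scale /= exprVn.
  by field.
- have [C HC] := flat_bound ('X * p).
  have f0 q : flat q 0 = 0 by rewrite /flat ltxx.
  have qE (h : R) : h != 0 -> h^-1 * flat p h = flat ('X * p) h.
    move=> h0; rewrite /flat; case: ifPn => hp; last by rewrite mulr0.
    by rewrite hornerM hornerX mulrA.
  have cv : (fun h : R => h^-1 *: ((flat p \o shift 0) (h *: 1) - flat p 0)) @ 0^' --> (0:R).
    apply/cvgr0Pnorm_lt => e e0.
    near=> h.
    rewrite /= addr0 f0 subr0 [h *: 1]mulr1 [_ *: _]qE; last by near: h; exact: nbhs_dnbhs_neq.
    apply: (le_lt_trans (HC h)).
    have C1 : 0 < `|C| + 1 by rewrite ltr_wpDl.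
    apply: (@le_lt_trans _ _ ((`|C| + 1) * `|h|)).
      by rewrite ler_wpM2r// ler_wpDr// ler_norm.
    rewrite mulrC -ltr_pdivlMr//.
    by near: h; apply: dnbhs0_lt; rewrite divr_gt0.
  rewrite f0; split; first by apply/cvg_ex; exists 0.
  exact: cvg_lim cv.
Unshelve. all: by end_near. Qed.

Lemma smooth_flat p : smooth (fun x : 'rV[R]_1 => flat p (x ord0 ord0)).
Proof.
apply/smoothP => N.
have cflat q : continuous (flat q).
  move=> x; apply: differentiable_continuous; apply/derivable1_diffP.
  by case: (is_derive_flat q x).
have cf q : continuous (fun x : 'rV[R]_1 => flat q (x ord0 ord0)).
  move=> x; apply: continuous_comp; [exact: coord_continuous | exact: cflat].
elim: N p => [//|N IH] p.
apply: (@smooth_uptoS _ _ _ (fun _ x => flat ('X^2 * (p - p^`())) (x ord0 ord0))) => //.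
move=> i x; rewrite (ord1 i); apply/is_derive_lineP.
have -> : (fun h : R => flat p ((h *: delta_mx ord0 ord0 + x) ord0 ord0)) =
    flat p \o (fun h => h + x ord0 ord0).
  by apply/funext => h /=; rewrite !mxE eqxx mulr1.
rewrite -[X in is_derive _ _ _ X]mulr1.
apply: is_derive1_comp; rewrite ?add0r; first exact: is_derive_flat.
exact: is_derive_shift.
Qed.

(** The bump is the product over the coordinates of [e(d + x_i) e(d - x_i)], where [e = flat 1] is
    [exp(-1/t)] for [t > 0] and [0] otherwise; the factor is positive exactly when [|x_i| < d]. *)
Lemma exists_bump n (d : R) : 0 < d ->
  exists rho : 'rV[R]_n -> R, [/\ smooth rho, 0 < rho 0 &
    forall x, rho x != 0 -> forall i, `|x ord0 i| <= d].
Proof.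
move=> d0.
(* Used with [s = 1] and [s = -1]; [A] is coordinatewise, so [smooth_comp] transports
   [smooth_flat]. *)
pose A s i (x : 'rV[R]_n) : 'rV[R]_1 := const_mx (d + s * x ord0 i).
pose b s i (x : 'rV[R]_n) := flat 1 (d + s * x ord0 i).
have sb s i : smooth (b s i).
  have -> : b s i = fun x => (fun y : 'rV[R]_1 => flat 1 (y ord0 ord0)) (A s i x).
    by apply/funext => x; rewrite /A mxE.
  apply: (smooth_comp _ _ (smooth_flat 1)) => [|j].
    apply: rV_continuous => k; under eq_fun do rewrite mxE.
    move=> y; apply: (@continuousD _ _ _ (fun=> d) (fun x : 'rV[R]_n => s * x ord0 i)).
      exact: cst_continuous.
    apply: (@continuousM _ _ (fun=> s) (fun x : 'rV[R]_n => x ord0 i)).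
      exact: cst_continuous.
    exact: coord_continuous.
  have [->|ij] := eqVneq j i.
    left; exists s, ord0 => h x; apply/rowP => k.
    by rewrite !mxE (ord1 k) !eqxx /=; ring.
  right=> h x; apply/rowP => k.
  by rewrite !mxE (eq_sym i) (negbTE ij) andbF mulr0 add0r.
have fgt x : (0 < flat 1 x) = (0 < x).
  by rewrite /flat; case: ifPn; rewrite ?ltxx// hornerC mul1r expR_gt0.
have fneq x : flat 1 x != 0 -> 0 < x by rewrite /flat; case: ifPn; rewrite ?eqxx.
exists (fun x => \prod_(i <- index_enum 'I_n) (b 1 i x * b (-1) i x)); split.
- by apply: smooth_prod => i; exact: smoothM.
- apply: prodr_gt0 => i _; rewrite /b !mxE !mulr0 !addr0.
  by rewrite mulr_gt0 ?fgt.
- move=> x /prodf_neq0 xn i; have := xn i isT.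
  rewrite mulf_eq0 negb_or => /andP[/fneq + /fneq].
  by rewrite ler_norml; lra.
Qed.

End smooth_calculus.

(** * Lebesgue measure on row vectors *)

Section rV_measurability.
Context {R : realType}.

(** The sigma-algebra is generated by the coordinates and not by the topology; an open set belongs
    to it as the countable union of the rational boxes that it contains. *)
Lemma rV_open_measurable n (U : set 'rV[R]_n) : open U -> measurable U.
Proof.
move=> oU.
pose B (qr : 'rV[rat]_n * rat) : set 'rV[R]_n :=
  [set x | forall i, `|x ord0 i - ratr (qr.1 ord0 i)| < ratr qr.2].
have mB qr : measurable (B qr).
  have -> : B qr = \bigcap_(i in [set: 'I_n])
      [set x | `|x ord0 i - ratr (qr.1 ord0 i)| < ratr qr.2].
    by apply/seteqP; split=> x /= h i; [move=> _; exact: h | exact: h i I].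
  apply: fin_bigcap_measurable => // i _.
  have mf : measurable_fun [set: 'rV[R]_n] (fun x : 'rV[R]_n => `|x ord0 i - ratr (qr.1 ord0 i)|).
    apply: measurableT_comp => //; apply: measurable_funB => //.
    exact: measurable_coord.
  have := mf measurableT _ (measurable_itv `]-oo, (ratr qr.2 : R)[).
  by rewrite setTI; congr (measurable _); apply/seteqP; split=> x /=; rewrite in_itv.
pose F qr : set 'rV[R]_n := if `[< B qr `<=` U >] then B qr else set0.
have -> : U = \bigcup_qr F qr.
  apply/seteqP; split=> [x Ux|x [qr _]]; last by rewrite /F; case: asboolP => // h /h.
  have /nbhs_ballP[e /= e0 eU] := open_nbhs_nbhs (conj oU Ux).
  (* With [r < e / 2], every point of the box is within [2 r < e] of [x], by the triangle inequality
     through the rational centre. *)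
  have [r /andP[r0 re]] : exists r : rat, 0 < (ratr r : R) < e / 2.
    have : (`]0, e / 2[%classic : set R) !=set0.
      by exists (e / 4); rewrite /= in_itv /=; apply/andP; split; lra.
    move=> /dense_rat/(_ (interval_open _ _))[] //= z [+ [r _ rz]].
    by rewrite in_itv /= -rz => hr; exists r.
  have hq i : exists q : rat, `|x ord0 i - ratr q| < ratr r.
    have : (`]x ord0 i - ratr r, x ord0 i + ratr r[%classic : set R) !=set0.
      by exists (x ord0 i); rewrite /= in_itv /=; apply/andP; split; lra.
    move=> /dense_rat/(_ (interval_open _ _))[] //= z [+ [q _ qz]].
    by rewrite in_itv /= -qz => /andP[h1 h2]; exists q; rewrite ltr_norml; apply/andP; split; lra.
  have [q hqi] := choice hq.
  exists (\row_i q i, r) => //.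
  have BU : B (\row_i q i, r) `<=` U.
    move=> y /= hy; apply: eU; split=> // a i; rewrite (ord1 a) /ball /=.
    have := hy i; have := hqi i; rewrite mxE /= => h1 h2.
    rewrite (_ : x ord0 i - y ord0 i =
      (x ord0 i - ratr (q i)) - (y ord0 i - ratr (q i))); last by ring.
    by apply: (le_lt_trans (ler_normB _ _)); lra.
  rewrite /F; case: asboolP => // _ i /=.
  by rewrite mxE; exact: hqi.
apply: countable_bigcupT_measurable => // qr.
by rewrite /F; case: asboolP.
Qed.

Lemma rV_continuous_measurable n (f : 'rV[R]_n -> R) :
  continuous f -> measurable_fun [set: 'rV[R]_n] f.
Proof.
move=> /continuousP cf; apply: (measurability _ (RGenOpens.measurableE R)).
move=> _ [_ [a [b ->] <-]]; rewrite setTI; apply: rV_open_measurable.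
exact/cf/interval_open.
Qed.

Lemma measurable_row_mx m k :
  measurable_fun setT (fun z : 'rV[R]_m * 'rV[R]_k => row_mx z.1 z.2).
Proof.
apply: measurable_fun_rV => i; under eq_fun do rewrite mxE.
case: (fintype.split i) => j.
  exact: (measurableT_comp (measurable_coord j) measurable_fst).
exact: (measurableT_comp (measurable_coord j) measurable_snd).
Qed.

Lemma measurable_scale_rV n (c : R) :
  measurable_fun setT (fun x : 'rV[R]_n => c *: x).
Proof.
apply: measurable_fun_rV => i; under eq_fun do rewrite mxE.
by apply: measurable_funM => //; exact: measurable_coord.
Qed.

End rV_measurability.

(** * Fubini's theorem and dilations for Lebesgue measure on row vectors *)

Section lebesgue_rV_integral.
Context {R : realType}.
Local Notation mu := (lebesgue_measure : measure _ R).
Local Open Scope ereal_scope.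

Lemma ge0_integral_cons_rV n (f : 'rV[R]_n.+1 -> \bar R) :
  measurable_fun setT f -> (forall x, 0 <= f x) ->
  \int[lebesgue_rV n.+1]_x f x =
  \int[lebesgue_measure \x lebesgue_rV n]_z f (cons_rV z).
Proof.
move=> mf f0; have mc := @measurable_cons_rV R n.
rewrite -(ge0_integral_pushforward mc (lebesgue_measure \x lebesgue_rV n) measurableT mf)//.
Qed.

Lemma ge0_integral_rVS n (f : 'rV[R]_n.+1 -> \bar R) :
  measurable_fun setT f -> (forall x, 0 <= f x) ->
  \int[lebesgue_rV n.+1]_x f x =
  \int[lebesgue_measure]_t \int[lebesgue_rV n]_v f (cons_rV (t, v)).
Proof.
move=> mf f0; have mc := @measurable_cons_rV R n.
rewrite ge0_integral_cons_rV//.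
rewrite fubini_tonelli1//.
exact: measurableT_comp.
Qed.

Lemma ge0_integral_rVS_swap n (f : 'rV[R]_n.+1 -> \bar R) :
  measurable_fun setT f -> (forall x, 0 <= f x) ->
  \int[lebesgue_rV n.+1]_x f x =
  \int[lebesgue_rV n]_v \int[lebesgue_measure]_t f (cons_rV (t, v)).
Proof.
move=> mf f0; have mc := @measurable_cons_rV R n.
rewrite ge0_integral_cons_rV//.
rewrite fubini_tonelli2//.
exact: measurableT_comp.
Qed.

Lemma integral_rVS n (f : 'rV[R]_n.+1 -> \bar R) :
  (lebesgue_rV n.+1).-integrable setT f ->
  \int[lebesgue_rV n.+1]_x f x =
    \int[lebesgue_measure]_t \int[lebesgue_rV n]_v f (cons_rV (t, v)) /\
  \int[lebesgue_rV n.+1]_x f x =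
    \int[lebesgue_rV n]_v \int[lebesgue_measure]_t f (cons_rV (t, v)).
Proof.
move=> intf; have mf := measurable_int _ intf.
have mc := @measurable_cons_rV R n.
have i2 : (lebesgue_measure \x lebesgue_rV n).-integrable setT (f \o @cons_rV R n).
  apply/integrableP; split; first exact: measurableT_comp.
  have /integrableP[_] := intf.
  rewrite ge0_integral_cons_rV//.
  exact: measurableT_comp.
have -> : \int[lebesgue_rV n.+1]_x f x =
    \int[lebesgue_measure \x lebesgue_rV n]_z (f \o @cons_rV R n) z.
  rewrite -(integral_pushforward mc mf i2 measurableT).
  exact: eq_measure_integral.
by split; [rewrite -(integral12_prod_meas1 i2) | rewrite -(integral21_prod_meas1 i2)].
Qed.

(** [m.+1 + k] and [(m + k).+1] are convertible, so both sides share a type; this is what lets the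
    induction on [m] below peel off the first coordinate of a concatenation. *)
Lemma row_mx_cons m k (t : R) (x : 'rV[R]_m) (y : 'rV[R]_k) :
  row_mx (cons_rV (t, x)) y = cons_rV (t, row_mx x y) :> 'rV[R]_(m + k).+1.
Proof.
apply/rowP => i; rewrite /cons_rV [RHS]mxE mxE /=.
case: unliftP => [j|] -> /=.
  rewrite !mxE; case: splitP => a.
    rewrite /= /bump /= add1n => ja.
    case: splitP => b jb /=.
      rewrite !mxE (_ : a = lift ord0 b) ?liftK//.
      by apply/val_inj; rewrite /= /bump /= -ja jb.
    by have := ltn_ord a; rewrite -ja jb ltnS ltnNge leq_addr.
  rewrite /= /bump /= add1n addSn => -[ja].
  case: splitP => b jb /=; first by have := ltn_ord b; rewrite -jb ja ltnNge leq_addr.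
  congr (y _ _); apply/val_inj => /=.
  by apply/eqP; rewrite -(eqn_add2l m) -ja jb.
case: splitP => a /= h; last by move: h; rewrite addSn.
rewrite mxE (_ : a = ord0) ?unlift_none//.
by apply/val_inj; rewrite /= -h.
Qed.

(** The induction follows the recursion defining [lebesgue_rV (m + k)], which peels off the
    coordinates of the first block; for [m = 0] the outer integral is against a Dirac mass. *)
Lemma ge0_integral_row_mx m k (f : 'rV[R]_(m + k) -> \bar R) :
  measurable_fun setT f -> (forall x, 0 <= f x) ->
  \int[lebesgue_rV (m + k)]_z f z =
  \int[lebesgue_rV m]_x \int[lebesgue_rV k]_y f (row_mx x y).
Proof.
elim: m f => [|m IH] f mf f0.
  have mF : measurable_fun setT
      (fun x : 'rV[R]_0 => \int[lebesgue_rV k]_y f (row_mx x y)).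
    apply: (measurable_fun_fubini_tonelli_F (fun z => f (row_mx z.1 z.2))) => //.
    by apply: measurableT_comp => //; exact: measurable_row_mx.
  rewrite [RHS]integral_dirac// diracT mul1e.
  by apply: eq_integral => y _; rewrite row_thin_mx.
have mf2 t : measurable_fun setT (fun v => f (cons_rV (t, v) : 'rV[R]_(m + k).+1)).
  apply: (measurable_fun_pair2 (f := fun z => f (cons_rV z))) => //.
  by apply: measurableT_comp => //; exact: measurable_cons_rV.
rewrite [LHS](@ge0_integral_rVS (m + k) f mf f0).
rewrite [RHS]ge0_integral_rVS; last 2 first.
- apply: (measurable_fun_fubini_tonelli_F (fun z => f (row_mx z.1 z.2))) => //.
  by apply: measurableT_comp => //; exact: measurable_row_mx.
- by move=> x; apply: integral_ge0.
apply: eq_integral => t _.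
rewrite (IH (fun v => f (cons_rV (t, v))) (mf2 t) (fun v => f0 _)).
by apply: eq_integral => x _; apply: eq_integral => y _; rewrite row_mx_cons.
Qed.

Definition cube n (M : R) : set 'rV[R]_n := [set x | forall i, (`|x ord0 i| <= M)%R].

Lemma measurable_cube n M : measurable (@cube n M).
Proof.
have -> : cube M = \bigcap_(i in [set: 'I_n]) [set x : 'rV[R]_n | (`|x ord0 i| <= M)%R].
  by apply/seteqP; split=> x /= h i; [move=> _; exact: h | exact: h i I].
apply: fin_bigcap_measurable => // i _.
have mf : measurable_fun [set: 'rV[R]_n] (fun x : 'rV[R]_n => `|x ord0 i|%R).
  by apply: measurableT_comp => //; exact: measurable_coord.
have := mf measurableT _ (measurable_itv `]-oo, M]).
by rewrite setTI; congr (measurable _); apply/seteqP; split=> x /=; rewrite in_itv.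
Qed.

Lemma lebesgue_cube n (M : R) : (0 <= M)%R ->
  lebesgue_rV n (@cube n M) = ((M *+ 2) ^+ n)%:E.
Proof.
move=> M0; elim: n => [|n IH].
  rewrite expr0 /= diracE (_ : _ \in _)//; apply/mem_set => -[].
  by [].
transitivity ((lebesgue_measure \x lebesgue_rV n) (`[(- M)%R, M]%classic `*` @cube n M)).
  rewrite /= /lebesgue_step /pushforward.
  rewrite (_ : _ @^-1` _ = `[(- M)%R, M]%classic `*` @cube n M)//.
  apply/seteqP; split=> -[t v] /= h.
    split.
      by have := h ord0; rewrite /cons_rV mxE unlift_none /= in_itv /= ler_norml.
    by move=> i; have := h (lift ord0 i); rewrite /cons_rV mxE liftK.
  case: h => h1 h2 i; rewrite /cons_rV mxE; case: unliftP => [j|] _ /=.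
    exact: h2.
  by move: h1; rewrite in_itv /= ler_norml.
rewrite product_measure1E//; last exact: measurable_cube.
rewrite IH exprS EFinM; congr (_ * _).
have : lebesgue_measure (`[(- M)%R, M]%classic : set R) = (M *+ 2)%:E; last by [].
have := @lebesgue_measure_itv R `[(- M)%R, M].
rewrite /= lte_fin; case: ifPn => [_ ->|]; first by rewrite -EFinB; congr EFin; ring.
rewrite -leNgt => MN ->; have -> : M = 0%R by apply/eqP; rewrite eq_le M0 andbT; lra.
by rewrite mul0rn.
Qed.

(** The image of Lebesgue measure under [t -> t / l], divided by [l], agrees with Lebesgue measure
    on the intervals []a, b]], hence everywhere by uniqueness. *)
Lemma ge0_integral_scale1 (l : R) (f : R -> \bar R) : (0 < l)%R ->
  measurable_fun setT f -> (forall x, 0 <= f x) ->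
  \int[lebesgue_measure]_t f (l^-1 * t)%R = l%:E * \int[lebesgue_measure]_t f t.
Proof.
move=> l0 mf f0.
have ml : measurable_fun setT (fun t : measurableTypeR R => (l^-1 * t)%R : measurableTypeR R).
  exact: mulrl_measurable.
have l0' : (0 <= l)%R by exact: ltW.
pose ln := NngNum l0'.
have E A : measurable A ->
    pushforward lebesgue_measure (fun t : measurableTypeR R => (l^-1 * t)%R : measurableTypeR R) A =
    mscale ln lebesgue_measure A.
  move=> mA.
  have li : (0 <= l^-1)%R by rewrite invr_ge0.
  pose lin := NngNum li.
  pose nu := mscale lin (pushforward lebesgue_measure
    (fun t : measurableTypeR R => (l^-1 * t)%R : measurableTypeR R)).
  have : lebesgue_measure A = nu ml A.
    apply: lebesgue_measure_unique => // _ [[a b]] _ <-.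
    have P : (fun t : measurableTypeR R => (l^-1 * t)%R) @^-1` `]a, b]%classic =
        `](l * a)%R, (l * b)%R]%classic.
      apply/seteqP; split=> t /=; rewrite !in_itv /= => /andP[h1 h2]; apply/andP.
        split; first by rewrite -ltr_pdivlMl.
        by rewrite -ler_pdivrMl.
      by split; [rewrite ltr_pdivlMl | rewrite ler_pdivrMl].
    transitivity ((l^-1)%:E *
      lebesgue_measure (`](l * a)%R, (l * b)%R]%classic : set R)); last first.
      by rewrite /nu /mscale /pushforward; congr (_ * lebesgue_measure _); exact/esym/P.
    have := @lebesgue_measure_itv R `](l * a)%R, (l * b)%R].
    have := @lebesgue_measure_itv R `]a, b].
    rewrite /= !lte_fin ltr_pM2l// => -> ->.
    case: ifPn => _; last by rewrite mule0.
    by rewrite -!EFinB -EFinM -mulrBr mulKf ?gt_eqF.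
  rewrite /nu /= /mscale /= => ->; rewrite muleA -EFinM divff ?gt_eqF// mul1e.
  by [].
rewrite -(@ge0_integral_mscale _ _ _ lebesgue_measure setT measurableT ln f)//.
rewrite -(eq_measure_integral _ (fun A mA _ => E A mA)).
by rewrite ge0_integral_pushforward.
Qed.

Lemma ge0_integral_scale n (l : R) (f : 'rV[R]_n -> \bar R) : (0 < l)%R ->
  measurable_fun setT f -> (forall x, 0 <= f x) ->
  \int[lebesgue_rV n]_x f (l^-1 *: x)%R = (l ^+ n)%:E * \int[lebesgue_rV n]_x f x.
Proof.
move=> l0; elim: n f => [|n IH] f mf f0.
  rewrite expr0 mul1e; apply: eq_integral => x _; congr f.
  by apply/rowP => -[].
have ms := @measurable_scale_rV R n.+1 l^-1.
have mc := @measurable_cons_rV R n.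
rewrite ge0_integral_rVS//; last exact: measurableT_comp.
rewrite ge0_integral_rVS//.
have mf2 t : measurable_fun setT (fun v => f (cons_rV (t, v))).
  apply: (measurable_fun_pair2 (f := fun z => f (cons_rV z))) => //.
  exact: measurableT_comp.
pose g t := \int[lebesgue_rV n]_v f (cons_rV (t, v)).
have mg : measurable_fun setT g.
  apply: (measurable_fun_fubini_tonelli_F (fun z => f (cons_rV z))) => //.
  exact: measurableT_comp.
have g0 t : 0 <= g t by apply: integral_ge0.
transitivity (\int[lebesgue_measure]_t ((l ^+ n)%:E * g (l^-1 * t)%R)).
  apply: eq_integral => t _; rewrite -(IH (fun v => f (cons_rV ((l^-1 * t)%R, v))))//.
  apply: eq_integral => v _; congr f; apply/rowP => i; rewrite /cons_rV !mxE.
  by case: unlift => //= j; rewrite mxE.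
rewrite ge0_integralZl_EFin; last 4 first.
- exact: measurableT.
- by move=> t _; exact: g0.
- by apply: (measurableT_comp mg); exact: mulrl_measurable.
- by rewrite exprn_ge0// ltW.
by rewrite ge0_integral_scale1// muleA -EFinM -exprSr.
Qed.

End lebesgue_rV_integral.

(** * Compactly supported functions *)

Lemma le_poweR (R : realType) (x y : \bar R) (r : R) :
  0 <= r -> (0 <= x -> x <= y -> x `^ r <= y `^ r)%E.
Proof.
move=> r0 x0 xy; apply: gt0_ler_poweR => //; rewrite in_itv /= leey andbT//.
exact: le_trans xy.
Qed.

Section Lnorm_extra.
Context d {T : measurableType d} {R : realType}.
Variables (mu : {measure set T -> \bar R}) (p : R).
Implicit Types f g : T -> R.
Local Open Scope ereal_scope.
Local Notation "''N_p' [ f ]" := (Lnorm mu p%:E (EFin \o f)).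

Lemma Lnorm_powR f : 'N_p[f] = (\int[mu]_x (`|f x| `^ p)%R%:E) `^ p^-1.
Proof.
by rewrite unlock /=; congr (_ `^ _); apply: eq_integral => x _.
Qed.

Lemma poweR_Lnorm_powR f : p != 0%R -> 'N_p[f] `^ p = \int[mu]_x (`|f x| `^ p)%R%:E.
Proof.
move=> p0; rewrite Lnorm_powR -poweRrM mulVf// poweRe1//.
by apply: integral_ge0 => x _; rewrite lee_fin powR_ge0.
Qed.

Lemma measurable_powR_norm f : measurable_fun setT f ->
  measurable_fun setT (fun x => (`|f x| `^ p)%R%:E).
Proof.
move=> mf; apply/measurable_EFinP.
apply: (@measurableT_comp _ _ _ _ _ _ (fun x : R => x `^ p)%R); first exact: measurable_powR.
exact: measurableT_comp.
Qed.

Lemma le_Lnorm f g : (0 < p)%R -> measurable_fun setT f -> measurable_fun setT g ->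
  (forall x, `|f x| <= `|g x|)%R -> 'N_p[f] <= 'N_p[g].
Proof.
move=> p0 mf mg fg; rewrite !Lnorm_powR; apply: le_poweR.
- by rewrite invr_ge0 ltW.
- by apply: integral_ge0 => x _; rewrite lee_fin powR_ge0.
- apply: ge0_le_integral => //; try exact: measurable_powR_norm.
  move=> x _; rewrite lee_fin.
  by apply: ge0_ler_powR => //; rewrite ?nnegrE ?ltW.
Qed.

Lemma Lnorm_scale (C : R) f : (0 < p)%R -> (0 <= C)%R -> measurable_fun setT f ->
  'N_p[(fun x => C * f x)%R] = C%:E * 'N_p[f].
Proof.
move=> p0 C0 mf; rewrite !Lnorm_powR.
under eq_integral do rewrite normrM powRM// EFinM (ger0_norm C0).
rewrite ge0_integralZl_EFin//; last 2 first.
- exact: measurable_powR_norm.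
- exact: powR_ge0.
rewrite poweRM ?lee_fin ?powR_ge0//; last first.
  by apply: integral_ge0 => x _; rewrite lee_fin powR_ge0.
by rewrite poweR_EFin -powRrM divff ?gt_eqF// powRr1.
Qed.

Lemma Lnorm_sum (I : Type) (s : seq I) (f : I -> T -> R) : (1 <= p)%R ->
  (forall i, measurable_fun setT (f i)) ->
  'N_p[(fun x => \sum_(i <- s) f i x)%R] <= \sum_(i <- s) 'N_p[f i].
Proof.
move=> p1 mf; have p0 : p != 0%R by rewrite gt_eqF// (lt_le_trans ltr01).
elim: s => [|i s IH].
  rewrite big_nil (_ : EFin \o _ = cst 0) ?Lnorm0 ?eqe//.
  by apply/funext => x /=; rewrite big_nil.
rewrite big_cons; apply: le_trans (leeD2l _ IH).
rewrite (_ : EFin \o _ = EFin \o (f i \+ (fun x => \sum_(i <- s) f i x))%R).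
  by apply: minkowski_EFin => //; exact: measurable_sum.
by apply/funext => x /=; rewrite big_cons.
Qed.

End Lnorm_extra.

Section rV_topology.
Context {R : realType}.

Lemma coord_le_norm n (x : 'rV[R]_n) i : `|x ord0 i| <= `|x|.
Proof. by rewrite [leRHS]/Num.norm /= mx_normrE; exact: (le_bigmax _ _ (ord0, i)). Qed.

Lemma closed_cube n (M : R) : closed (@cube R n M).
Proof.
have -> : cube M = \bigcap_(i in [set: 'I_n])
    ((fun x : 'rV[R]_n => x ord0 i) @^-1` `[- M, M]%classic).
  apply/seteqP; split=> x /= h i.
    by move=> _ /=; rewrite in_itv /= -ler_norml.
  by have := h i I; rewrite /= in_itv /= -ler_norml.
apply: closed_bigI => i _; apply: preimage_closed; last exact: interval_closed.
by move=> x _; exact: coord_continuous.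
Qed.

Lemma compact_cube n (M : R) : compact (@cube R n M).
Proof.
have -> : cube M = [set v : 'rV[R]_n | forall i, `[- M, M]%classic (v ord0 i)].
  by apply/seteqP; split=> x /= h i; have := h i; rewrite /= in_itv /= -ler_norml.
by apply: (@rV_compact R n (fun=> `[- M, M]%classic)) => _; exact: segment_compact.
Qed.

Lemma bounded_set_cube n (A : set 'rV[R]_n) : bounded_set A ->
  exists2 M : R, 0 < M & forall x, A x -> forall i, `|x ord0 i| < M.
Proof.
(* One unit to exceed the bound [N], a second one to make the inequality strict. *)
move=> [N [Nr NA]]; exists (`|N| + 2) => [|x Ax i]; first by rewrite ltr_wpDl.
apply: (le_lt_trans (coord_le_norm x i)).
have /NA/(_ x Ax) : N < `|N| + 1 by rewrite ltr_pwDr// ler_norm.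
by move=> /le_lt_trans; apply; rewrite ltrD2l ltr1n.
Qed.

Lemma support_closure n (f : 'rV[R]_n -> R) (K : set 'rV[R]_n) :
  closed K -> (forall x, f x != 0 -> K x) -> closure [set x | f x != 0] `<=` K.
Proof.
by move=> /closure_id {2}-> fK; apply: closureS => x; exact: fK.
Qed.

(** Off the closed set [K] the function vanishes in a neighbourhood, not just at the point, so its
    derivatives vanish there too. *)
Lemma partial_support n (f : 'rV[R]_n -> R) i (K : set 'rV[R]_n) :
  closed K -> (forall x, f x != 0 -> K x) -> forall x, partial i f x != 0 -> K x.
Proof.
move=> cK fK x; apply: contra_neqP => nKx.
have oK : open (~` K) by exact: closed_openC.
have : \forall y \near x, f y = cst 0 y.
  near=> y; apply/eqP; apply: contraPT (fK y) => /= fy.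
  have : (~` K) y by near: y; exact: open_nbhs_nbhs.
  by move=> nK h; apply: nK; exact: h.
by move=> /near_eq_derive E; rewrite /partial E derive_cst.
Unshelve. all: by end_near. Qed.

Lemma continuous_cons_rV n (t : R) : continuous (fun v : 'rV[R]_n => cons_rV (t, v) : 'rV[R]_n.+1).
Proof.
apply: rV_continuous => i; rewrite /cons_rV; under eq_fun do rewrite mxE.
case: unliftP => [j|] _ /=; first exact: coord_continuous.
exact: cst_continuous.
Qed.

Lemma continuous_cons_rV1 n (v : 'rV[R]_n) : continuous (fun t : R => cons_rV (t, v) : 'rV[R]_n.+1).
Proof.
apply: rV_continuous => i; rewrite /cons_rV; under eq_fun do rewrite mxE.
by case: unliftP => [j|] _ /=; [exact: cst_continuous | move=> x].
Qed.

Lemma cons_rV_delta n (h t : R) (v : 'rV[R]_n) :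
  cons_rV (h + t, v) = h *: delta_mx ord0 ord0 + cons_rV (t, v) :> 'rV[R]_n.+1.
Proof.
apply/rowP => i; rewrite /cons_rV !mxE; case: unliftP => [j|] -> /=.
  by rewrite mulr0 add0r.
by rewrite mulr1.
Qed.

Lemma cons_rV_delta_lift n (h t : R) (v : 'rV[R]_n) j :
  cons_rV (t, h *: delta_mx ord0 j + v) =
  h *: delta_mx ord0 (lift ord0 j) + cons_rV (t, v) :> 'rV[R]_n.+1.
Proof.
apply/rowP => i; rewrite /cons_rV !mxE; case: unliftP => [k|] -> /=.
  by rewrite !mxE (inj_eq (@lift_inj _ ord0)).
by rewrite mulr0 add0r.
Qed.

End rV_topology.

(** * Integrals of compactly supported functions and of their derivatives *)

Section compact_support.
Context {R : realType}.
Local Open Scope ereal_scope.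

Lemma bounded_of_support n (f : 'rV[R]_n -> R) M : continuous f ->
  (forall x, f x != 0%R -> cube M x) -> exists2 B : R, (0 <= B)%R & forall x, (`|f x| <= B)%R.
Proof.
move=> cf fM.
have /compact_bounded[N [Nr NA]] : compact (f @` cube M).
  apply: continuous_compact; last exact: compact_cube.
  exact: continuous_subspaceT.
exists (`|N| + 1)%R => [|x]; first by rewrite addr_ge0.
have [->|fx] := eqVneq (f x) 0%R; first by rewrite normr0 addr_ge0.
apply: (NA (`|N| + 1)%R); first by rewrite ltr_pwDr// ler_norm.
by exists x => //; exact: fM.
Qed.

Lemma integral_powR_support n (f : 'rV[R]_n -> R) M p : (0 < p)%R -> continuous f ->
  (forall x, f x != 0%R -> cube M x) ->
  \int[lebesgue_rV n]_x (`|f x| `^ p)%R%:E < +oo.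
Proof.
move=> p0 cf fM; have [B B0 fB] := bounded_of_support cf fM.
have fM' x : f x != 0%R -> cube `|M| x.
  by move=> /fM h i; exact: le_trans (h i) (ler_norm _).
apply: (@le_lt_trans _ _ (\int[lebesgue_rV n]_x ((B `^ p)%:E * (\1_(@cube R n `|M|) x)%:E))).
  apply: ge0_le_integral => //.
  - by apply: measurable_powR_norm; exact: rV_continuous_measurable.
  - apply/measurable_EFinP; apply: measurable_funM => //.
    by apply: measurable_indic; exact: measurable_cube.
  - move=> x _; rewrite -EFinM lee_fin indicE.
    have [/eqP ->|/fM' fx] := boolP (f x == 0%R).
      by rewrite normr0 powR0 ?gt_eqF// mulr_ge0// powR_ge0.
    by rewrite mem_set//= mulr1; apply: ge0_ler_powR => //; rewrite ?nnegrE ?ltW.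
have mC := @measurable_cube R n `|M|.
rewrite ge0_integralZl_EFin//; last 2 first.
- by apply/measurable_EFinP; exact: measurable_indic.
- exact: powR_ge0.
rewrite integral_indic// setIT.
have E := lebesgue_cube n (normr_ge0 M).
apply: (@le_lt_trans _ _ ((B `^ p)%:E * ((`|M| *+ 2) ^+ n)%:E)); first by rewrite -E.
by rewrite -EFinM ltry.
Qed.

Lemma integrable_support n (f : 'rV[R]_n -> R) M : continuous f ->
  (forall x, f x != 0%R -> cube M x) -> (lebesgue_rV n).-integrable setT (EFin \o f).
Proof.
move=> cf fM; apply/integrableP; split.
  by apply/measurable_EFinP; exact: rV_continuous_measurable.
have := integral_powR_support ltr01 cf fM.
by under eq_integral do rewrite powRr1//.
Qed.

Lemma Lfun_support n (f : 'rV[R]_n -> R) M p : (0 < p)%R -> continuous f ->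
  (forall x, f x != 0%R -> cube M x) -> f \in Lfun (lebesgue_rV n) p%:E.
Proof.
move=> p0 cf fM; rewrite inE; apply/andP; split; rewrite inE /=.
  exact: rV_continuous_measurable.
rewrite /finite_norm unlock /= poweR_lty//.
exact: integral_powR_support cf fM.
Qed.

Lemma ftc_is_derive (h h' : R -> R) a b : (a < b)%R ->
  (forall t, is_derive t (1%R : R) h (h' t)) -> continuous h' ->
  \int[lebesgue_measure]_(t in `[a, b]) (h' t)%:E = (h b - h a)%:E.
Proof.
move=> ab dh ch'.
have ch : continuous h.
  move=> t; apply: differentiable_continuous; apply/derivable1_diffP.
  by case: (dh t).
rewrite (@continuous_FTC2 R h' h)//.
- exact: continuous_subspaceT.
- split.
  + by move=> t _; case: (dh t).
  + exact/cvg_at_right_filter/ch.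
  + exact/cvg_at_left_filter/ch.
- by move=> t _; rewrite derive1E; case: (dh t).
Qed.

Lemma integral_derive_support (h h' : R -> R) M :
  (forall t, is_derive t (1%R : R) h (h' t)) -> continuous h' ->
  (forall t, h t != 0 -> `|t| <= M)%R ->
  \int[lebesgue_measure]_t (h' t)%:E = 0.
Proof.
(* [N] is positive and strictly beyond the support, so that [h] vanishes at both ends of
   [[-N, N]]. *)
move=> dh ch' hM; pose N : R := (`|M| + 1)%R.
have hN t : (h t != 0 -> `|t| < N)%R.
  by move=> /hM /le_lt_trans; apply; rewrite ltr_pwDr// ler_norm.
have h0 t : (N <= `|t| -> h t = 0)%R.
  by move=> Nt; apply/eqP; apply: contraTT Nt => /hN; rewrite -ltNge.
have h'0 t : (h' t != 0 -> `|t| <= N)%R.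
  apply: contra_neqT; rewrite -ltNge => Nt.
  have E : \forall s \near t, h s = cst 0%R s.
    near=> s; apply: h0; apply: ltW; near: s.
    by apply: (cvgr_gt `|t|%R) Nt; apply: cvg_norm; exact: cvg_id.
  by have [_ <-] := dh t; rewrite (near_eq_derive _ E) derive_cst.
have N0 : (0 < N)%R by rewrite ltr_wpDl.
transitivity (\int[lebesgue_measure]_(t in `[(- N)%R, N]) (h' t)%:E).
  rewrite [RHS]integral_mkcond; apply: eq_integral => t _.
  rewrite patchE; case: ifPn => // /negP tN.
  have [/eqP ->//|/h'0 tn] := boolP (h' t == 0%R).
  by exfalso; apply: tN; rewrite inE /= in_itv /= -ler_norml.
rewrite (ftc_is_derive _ dh ch'); last lra.
by rewrite !h0 ?normrN ?gtr0_norm// subrr.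
Unshelve. all: by end_near. Qed.

Lemma is_derive_cons_rV n (f : 'rV[R]_n.+1 -> R) v t : smooth f ->
  is_derive t (1%R : R) (fun t => f (cons_rV (t, v))) (partial ord0 f (cons_rV (t, v))).
Proof.
move=> sf; have := is_derive_partial ord0 (cons_rV (t, v)) sf.
move=> /is_derive_lineP.
under eq_fun do rewrite -cons_rV_delta.
move=> [d1 d2]; pose g (t : R) := f (cons_rV (t, v)).
have E : (fun h : R => h^-1 *: ((g \o shift t) (h *: 1%R) - g t)) =
    (fun h : R => h^-1 *: (((fun h => g (h + t)) \o shift 0) (h *: 1%R) - g (0 + t)))%R.
  by apply/funext => h /=; rewrite addr0 add0r.
by split; rewrite /derivable /derive E.
Qed.

(** For the first coordinate, integrate it innermost and apply the fundamental theorem of calculus.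
    For another coordinate, integrate the first one outermost: each slice is a smooth compactly
    supported function in one dimension less. *)
Lemma integral_partial n (f : 'rV[R]_n -> R) M i : smooth f ->
  (forall x, f x != 0%R -> cube M x) ->
  \int[lebesgue_rV n]_x (partial i f x)%:E = 0.
Proof.
elim: n f i => [|n IH] f i sf fM; first by case: i.
have intf : (lebesgue_rV n.+1).-integrable setT (EFin \o partial i f).
  apply: integrable_support; first exact: smooth_continuous (smooth_partial i sf).
  by apply: (partial_support _ fM); exact: closed_cube.
have [/= E1 E2] := integral_rVS intf.
have [j|] := unliftP ord0 i => ij; rewrite ij in E1 E2 *.
  rewrite E1; apply: integral0_eq => t _.
  under eq_integral => v _.
    have := @partial_comp_dir R n n.+1 (fun v => cons_rV (t, v)) f j (lift ord0 j) 1 v.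
    rewrite mul1r => <- //; last by move=> h; rewrite mulr1 cons_rV_delta_lift.
    over.
  apply: IH => [|x /fM h k].
    apply: smooth_comp => //; first exact: continuous_cons_rV.
    move=> k; left; exists 1%R, (lift ord0 k) => h x.
    by rewrite mulr1 cons_rV_delta_lift.
  by have := h (lift ord0 k); rewrite /cons_rV mxE liftK.
rewrite E2; apply: integral0_eq => v _.
apply: (@integral_derive_support (fun t => f (cons_rV (t, v))) _ M).
- by move=> t; exact: is_derive_cons_rV.
- move=> t; apply: (continuous_comp (@continuous_cons_rV1 R n v t)).
  exact: smooth_continuous (smooth_partial _ sf) _.
- move=> t /fM/(_ ord0); rewrite /cons_rV mxE unlift_none /=; exact.
Qed.

End compact_support.

(** * Test functions as elements of W_0^{1,p} *)

Section test_functions.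
Context {R : realType} {n : nat}.
Implicit Types (Omega : set 'rV[R]_n) (phi : 'rV[R]_n -> R).

(** The closure of the nonzero set has to stay in [Omega]; a closed [K] between the two ensures
    this, and the cube gives compactness. *)
Lemma test_funI Omega phi K M : smooth phi -> closed K -> K `<=` Omega ->
  (forall x, phi x != 0 -> K x) -> (forall x, phi x != 0 -> cube M x) ->
  test_fun Omega phi.
Proof.
move=> sphi cK KO pK pM; split=> //.
  apply: subclosed_compact (@compact_cube R n M) _; first exact: closed_closure.
  by apply: support_closure pM; exact: closed_cube.
exact: subset_trans (support_closure cK pK) KO.
Qed.

Lemma test_fun_cube Omega phi : test_fun Omega phi ->
  exists2 M, 0 < M & forall x, phi x != 0 -> cube M x.
Proof.
move=> [_ cs _]; have [M M0 hM] := bounded_set_cube (compact_bounded cs).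
by exists M => // x px i; apply: ltW; apply: hM; exact: subset_closure.
Qed.

Lemma test_fun_support Omega phi x : test_fun Omega phi -> phi x != 0 -> Omega x.
Proof. by move=> [_ _ sO] px; apply: sO; exact: subset_closure. Qed.

Lemma test_fun_partial Omega phi i : test_fun Omega phi -> test_fun Omega (partial i phi).
Proof.
move=> tp; have [M _ pM] := test_fun_cube tp; have [sp cp pO] := tp.
apply: (@test_funI _ _ (closure [set x | phi x != 0]) M).
- exact: smooth_partial.
- exact: closed_closure.
- exact: pO.
- by apply: partial_support; [exact: closed_closure | exact: subset_closure].
- by apply: partial_support pM; exact: closed_cube.
Qed.

Lemma test_fun_restrict Omega phi : test_fun Omega phi -> phi \_ Omega = phi.
Proof.
move=> tp; apply/funext => x; rewrite patchE; case: ifPn => // /negP xO.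
apply/esym/eqP; apply/negPn/negP => /(test_fun_support tp) Ox.
by apply: xO; rewrite inE.
Qed.

Lemma test_fun_integral Omega phi (K : R -> \bar R) : test_fun Omega phi -> K 0 = 0%E ->
  (\int[lebesgue_rV n]_(x in Omega) K (phi x) = \int[lebesgue_rV n]_x K (phi x))%E.
Proof.
move=> tp K0; rewrite integral_mkcond; apply: eq_integral => x _.
rewrite patchE; case: ifPn => // /negP xO.
have [->//|/(test_fun_support tp) Ox] := eqVneq (phi x) 0.
by exfalso; apply: xO; rewrite inE.
Qed.

Lemma grad_test_fun_support Omega phi x : test_fun Omega phi -> grad phi x != 0 -> Omega x.
Proof.
move=> tp gx; have [i] : exists i, grad phi x ord0 i != 0.
  apply/existsP; apply: contraNT gx; rewrite negb_exists => /forallP h.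
  by apply/eqP/rowP => i; have := h i; rewrite negbK => /eqP ->; rewrite mxE.
by rewrite mxE; exact: (test_fun_support (test_fun_partial i tp)).
Qed.

Lemma Lp_test_fun Omega phi p : 0 < p -> test_fun Omega phi -> Lp Omega p phi.
Proof.
move=> p0 tp; have [M _ pM] := test_fun_cube tp; have [sp _ _] := tp.
rewrite /Lp test_fun_restrict//.
exact: Lfun_support p0 (smooth_continuous sp) pM.
Qed.

Lemma test_fun_smoothM Omega phi psi : test_fun Omega phi -> smooth psi ->
  test_fun Omega (fun x => phi x * psi x).
Proof.
move=> tp spsi; have [M _ pM] := test_fun_cube tp; have [sp _ pO] := tp.
have pn x : phi x * psi x != 0 -> phi x != 0.
  by apply: contra_neq => ->; rewrite mul0r.
apply: (@test_funI _ _ (closure [set x | phi x != 0]) M).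
- exact: (smoothM sp spsi).
- exact: closed_closure.
- exact: pO.
- by move=> x /pn px; exact: subset_closure.
- by move=> x /pn; exact: pM.
Qed.

Lemma test_fun_integrable Omega phi : test_fun Omega phi ->
  (lebesgue_rV n).-integrable setT (EFin \o phi).
Proof.
move=> tp; have [M _ pM] := test_fun_cube tp; have [sp _ _] := tp.
exact: integrable_support (smooth_continuous sp) pM.
Qed.

(** Integration by parts: [u * phi] has bounded support, so its partial derivative integrates to [0]
    by [integral_partial], and the product rule splits it into the two terms. *)
Lemma weak_gradient_test_fun Omega u : test_fun Omega u -> weak_gradient Omega u (grad u).
Proof.
move=> tu phi tphi i; have [su _ _] := tu; have [sphi _ _] := tphi.
have t1 := test_fun_smoothM tu (smooth_partial i sphi).
have t2 := test_fun_smoothM tphi (smooth_partial i su).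
rewrite [LHS]Rintegral_mkcond [X in - X]Rintegral_mkcond (test_fun_restrict t1).
rewrite (_ : (fun x => grad u x ord0 i * phi x) \_ Omega =
  fun x => phi x * partial i u x); last first.
  rewrite -[RHS](test_fun_restrict t2); congr (_ \_ _).
  by apply/funext => x; rewrite mxE mulrC.
apply/eqP; rewrite -subr_eq0 opprK -RintegralD//; last 2 first.
- exact: test_fun_integrable t1.
- exact: test_fun_integrable t2.
have t3 := test_fun_smoothM tu sphi; have [s3 _ _] := t3.
have [M _ pM] := test_fun_cube t3.
rewrite /Rintegral.
under eq_integral do rewrite -partialM//.
by rewrite (integral_partial i s3 pM).
Qed.

Lemma sobolev0_test_fun Omega p u : 0 < p -> test_fun Omega u ->
  sobolev0 Omega p u (grad u).
Proof.
move=> p0 tu; split; first split.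
- exact: Lp_test_fun.
- move=> i; rewrite (_ : (fun x => _) = partial i u); last by apply/funext => x; rewrite mxE.
  by apply: Lp_test_fun => //; exact: test_fun_partial.
- exact: weak_gradient_test_fun.
move=> e e0; exists u => //; rewrite /sobolev_norm.
have L0 (f : 'rV[R]_n -> R) : (forall x, f x = 0) -> Lp_norm Omega p f = 0%E.
  move=> f0; rewrite /Lp_norm (_ : EFin \o _ = cst 0%E) ?Lnorm0//.
    by rewrite eqe gt_eqF.
  by apply/funext => x /=; rewrite patchE; case: ifP; rewrite ?f0.
rewrite L0; last by move=> x /=; rewrite subrr.
rewrite big1 ?adde0 ?lte_fin// => i _.
by apply: L0 => x; rewrite subrr mxE.
Qed.

End test_functions.

(** * Rayleigh quotients of test functions *)

Section seminorms.
Context {R : realType}.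

(** These are the properties of [H] on which the density argument rests. They pass to
    [fun y => K (row_mx 0 y)], so the quotients on the cylinder and on [omega2] are treated
    together. *)
Definition seminorm n (K : 'rV[R]_n -> R) := [/\ forall x, 0 <= K x,
  forall x y, K (x + y) <= K x + K y & forall t x, K (t *: x) = `|t| * K x].

Lemma seminorm0 n (K : 'rV[R]_n -> R) : seminorm K -> K 0 = 0.
Proof. by move=> [_ _ /(_ 0 0)]; rewrite scale0r normr0 mul0r. Qed.

Lemma seminorm_bound n (K : 'rV[R]_n -> R) : seminorm K ->
  exists2 C, 0 <= C & forall x, K x <= C * \sum_i `|x ord0 i|.
Proof.
move=> sK; have [K0 KD KZ] := sK; exists (\sum_i K (delta_mx ord0 i)).
  by apply: sumr_ge0.
move=> x; rewrite {1}(row_sum_delta x).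
have Ksum (s : seq 'I_n) : K (\sum_(i <- s) x ord0 i *: delta_mx ord0 i) <=
    \sum_(i <- s) `|x ord0 i| * K (delta_mx ord0 i).
  elim: s => [|i s IH]; first by rewrite !big_nil seminorm0.
  by rewrite !big_cons; apply: (le_trans (KD _ _)); rewrite KZ lerD2l.
apply: (le_trans (Ksum _)); rewrite mulr_sumr; apply: ler_sum => i _.
rewrite mulrC ler_wpM2r// (bigD1 i)//= lerDl; exact: sumr_ge0.
Qed.

(** [|K x - K y| <= K (x - y)], and the right side is at most [C n |x - y|] by [seminorm_bound]. It
    serves to make [K (g x)] measurable. *)
Lemma seminorm_continuous n (K : 'rV[R]_n -> R) : seminorm K -> continuous K.
Proof.
move=> sK x; have [C C0 KC] := seminorm_bound sK; have [K0 KD KZ] := sK.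
apply/(@cvgrPdist_lt R R^o _ (nbhs x) _ K (K x)) => e e0.
have C1 : 0 < C * n%:R + 1 by rewrite ltr_wpDl// mulr_ge0.
near=> y.
have Kxy : `|K x - K y| <= K (x - y).
  rewrite ler_norml; apply/andP; split.
    rewrite lerNl opprB lerBlDr; have := KD (y - x) x; rewrite subrK => /le_trans; apply.
    by rewrite lerD2r -(opprB x) -scaleN1r KZ normrN1 mul1r.
  by rewrite lerBlDr; have := KD (x - y) y; rewrite subrK.
apply: (le_lt_trans Kxy); apply: (le_lt_trans (KC _)).
have xy : `|x - y| < e / (C * n%:R + 1).
  by near: y; apply: cvgr_dist_lt => //; rewrite divr_gt0.
apply: (@le_lt_trans _ _ ((C * n%:R + 1) * `|x - y|)); last first.
  by rewrite mulrC -ltr_pdivlMr.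
apply: (@le_trans _ _ (C * (n%:R * `|x - y|))).
  apply: ler_wpM2l => //; rewrite mulr_natl -[X in _ *+ X](card_ord n) -sumr_const.
  by apply: ler_sum => i _; exact: coord_le_norm.
by rewrite mulrA ler_wpM2r// lerDl.
Unshelve. all: by end_near. Qed.

Lemma measurable_seminorm d (T : measurableType d) n (K : 'rV[R]_n -> R) (g : T -> 'rV[R]_n) :
  seminorm K -> (forall i, measurable_fun setT (fun x => g x ord0 i)) ->
  measurable_fun setT (fun x => K (g x)).
Proof.
move=> sK mg; apply: (@measurableT_comp _ _ _ _ _ _ K).
  by apply: rV_continuous_measurable; exact: seminorm_continuous.
exact: measurable_fun_rV.
Qed.

End seminorms.

Section rayleigh.
Context {R : realType} {n : nat}.
Variables (Omega : set 'rV[R]_n) (p : R) (K : 'rV[R]_n -> R).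
Hypotheses (p1 : 1 <= p) (sK : seminorm K).
Local Notation mu := (lebesgue_rV n).
Local Open Scope ereal_scope.

Let p0 : (0 < p)%R. Proof. exact: lt_le_trans p1. Qed.

Let pn0 : p != 0%R. Proof. by rewrite gt_eqF. Qed.

Let K0 := seminorm0 sK.

Let Kge0 x : (0 <= K x)%R. Proof. by case: sK. Qed.

Let measurable_grad phi i : test_fun Omega phi -> measurable_fun setT (partial i phi).
Proof.
move=> [sp _ _]; apply: rV_continuous_measurable.
exact: smooth_continuous (smooth_partial i sp).
Qed.

Let measurable_K_grad phi : test_fun Omega phi -> measurable_fun setT (fun x => K (grad phi x)).
Proof.
move=> tp; apply: (measurable_seminorm sK) => i.
rewrite (_ : (fun x => _) = partial i phi); first exact: measurable_grad.
by apply/funext => x; rewrite mxE.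
Qed.

(** A test function with its classical gradient is admissible, so its own quotient bounds the
    infimum; its denominator is finite because the support is compact. *)
Lemma rayleigh_inf_le (A : R) phi : (0 <= A)%R -> A%:E <= rayleigh_inf Omega p K ->
  test_fun Omega phi ->
  A%:E * \int[mu]_x (`|phi x| `^ p)%R%:E <= \int[mu]_x (K (grad phi x) `^ p)%R%:E.
Proof.
move=> A0 Ainf tp; have [sp _ _] := tp.
have mphi := rV_continuous_measurable (smooth_continuous sp).
have I0 : 0 <= \int[mu]_x (`|phi x| `^ p)%R%:E.
  by apply: integral_ge0 => x _; rewrite lee_fin powR_ge0.
(* A [phi] that vanishes almost everywhere is not admissible, but then the left side is [0]. *)
have [->|In0] := eqVneq (\int[mu]_x (`|phi x| `^ p)%R%:E) 0.
  by rewrite mule0; apply: integral_ge0 => x _; rewrite lee_fin powR_ge0.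
have Ifin : \int[mu]_x (`|phi x| `^ p)%R%:E \is a fin_num.
  rewrite ge0_fin_numE//; have [M _ pM] := test_fun_cube tp.
  exact: integral_powR_support (smooth_continuous sp) pM.
have num : \int[mu]_(x in Omega) (K (grad phi x) `^ p)%R%:E =
    \int[mu]_x (K (grad phi x) `^ p)%R%:E.
  rewrite integral_mkcond; apply: eq_integral => x _.
  rewrite patchE; case: ifPn => // /negP xO.
  have [->|/(grad_test_fun_support tp) Ox] := eqVneq (grad phi x) 0%R.
    by rewrite K0 powR0.
  by exfalso; apply: xO; rewrite inE.
have den : \int[mu]_(x in Omega) (`|phi x| `^ p)%R%:E = \int[mu]_x (`|phi x| `^ p)%R%:E.
  by apply: (@test_fun_integral _ _ _ _ (fun t => (`|t| `^ p)%R%:E)) => //; rewrite normr0 powR0.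
have : rayleigh_inf Omega p K <= rayleigh_quotient Omega p K phi (grad phi).
  apply: ereal_inf_lbound; exists phi, (grad phi); split => //.
    exact: sobolev0_test_fun.
  move=> phi0; move/eqP: In0; apply.
  transitivity (\int[mu]_x (cst 0 x : \bar R)); last exact: integral0.
  apply: ae_eq_integral => //; first exact: measurable_powR_norm.
  move: phi0; apply: filterS => x hx _.
  have [->|phix] := eqVneq (phi x) 0%R; first by rewrite normr0 powR0.
  by rewrite hx ?normr0 ?powR0//; exact: test_fun_support tp phix.
move=> /(le_trans Ainf); rewrite /rayleigh_quotient num den.
have fI : (0 < fine (\int[mu]_x (`|phi x| `^ p)%R%:E))%R.
  by apply: fine_gt0; rewrite lt0e In0 I0 -(ge0_fin_numE I0) Ifin.
by rewrite -(fineK Ifin) inver (gt_eqF fI) (lee_pdivlMr _ _ fI).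
Qed.

(** After taking [p]-th roots the hypothesis reads [a ||phi|| <= ||K(grad phi)||] in L^p norms, and
    both sides depend continuously on [(phi, grad phi)] in L^p, so it extends to the closure. *)
Lemma rayleigh_inf_ge (A : R) : (0 <= A)%R ->
  (forall phi, test_fun Omega phi ->
    A%:E * \int[mu]_x (`|phi x| `^ p)%R%:E <= \int[mu]_x (K (grad phi x) `^ p)%R%:E) ->
  A%:E <= rayleigh_inf Omega p K.
Proof.
move=> A0 hA; apply: le_ereal_inf_tmp => _ [v [g [[[Lv Lg wg] dv] vn0 ->]]].
(* Extensions by [0]: the values of [v] and [g] outside [Omega] are arbitrary, and norms are taken
   over the whole space. *)
pose v' := v \_ Omega; pose g' x : 'rV[R]_n := if x \in Omega then g x else 0%R.
have mv : measurable_fun setT v'.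
  by have := sub_Lfun_mfun Lv; rewrite inE.
have g'E i : (fun x => g' x ord0 i) = (fun x => g x ord0 i) \_ Omega.
  by apply/funext => x; rewrite patchE /g'; case: ifP => //; rewrite mxE.
have mg i : measurable_fun setT (fun x => g' x ord0 i).
  by rewrite g'E; have := sub_Lfun_mfun (Lg i); rewrite inE.
have mK : measurable_fun setT (fun x => K (g' x)) by exact: measurable_seminorm.
have num : \int[mu]_(x in Omega) (K (g x) `^ p)%R%:E = \int[mu]_x (K (g' x) `^ p)%R%:E.
  rewrite integral_mkcond; apply: eq_integral => x _.
  by rewrite patchE /g'; case: ifPn => // _; rewrite K0 powR0.
have den : \int[mu]_(x in Omega) (`|v x| `^ p)%R%:E = \int[mu]_x (`|v' x| `^ p)%R%:E.
  rewrite integral_mkcond; apply: eq_integral => x _.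
  by rewrite /v' !patchE; case: ifPn => // _; rewrite normr0 powR0.
have I0 : 0 <= \int[mu]_x (`|v' x| `^ p)%R%:E.
  by apply: integral_ge0 => x _; rewrite lee_fin powR_ge0.
have Ifin : \int[mu]_x (`|v' x| `^ p)%R%:E \is a fin_num.
  have E : 'N[mu]_p%:E[EFin \o v'] `^ p = \int[mu]_x (`|v' x| `^ p)%R%:E.
    exact: poweR_Lnorm_powR.
  rewrite (ge0_fin_numE I0) -E; apply: poweR_lty.
  by have := sub_Lfun_finLfun Lv; rewrite inE.
(* A zero denominator would force [v = 0] almost everywhere on [Omega], against [vn0]. *)
have In0 : \int[mu]_x (`|v' x| `^ p)%R%:E != 0.
  apply/eqP => I00; apply: vn0.
  have : \int[mu]_x `|(`|v' x| `^ p)%R%:E| = 0.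
    by rewrite -[RHS]I00; apply: eq_integral => x _; rewrite gee0_abs// lee_fin powR_ge0.
  move/(ae_eq_integral_abs mu measurableT (measurable_powR_norm p mv)).
  apply: filterS => x /(_ I) /= [] /powR_eq0_eq0 /normr0_eq0 + Ox.
  by rewrite /v' patchE mem_set.
have [C C0 KC] := seminorm_bound sK.
have key : A%:E * \int[mu]_x (`|v' x| `^ p)%R%:E <= \int[mu]_x (K (g' x) `^ p)%R%:E.
  pose a := (A `^ p^-1)%R; have a0 : (0 <= a)%R by exact: powR_ge0.
  pose N (f : 'rV[R]_n -> R) := 'N[mu]_p%:E[EFin \o f].
  have NG f : 0 <= N f by exact: Lnorm_ge0.
  suff H : a%:E * N v' <= N (fun x => K (g' x)).
    have a0' : 0 <= a%:E by rewrite lee_fin.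
    have e1 : N v' `^ p = \int[mu]_x (`|v' x| `^ p)%R%:E := poweR_Lnorm_powR mu v' pn0.
    have e2 : N (fun x => K (g' x)) `^ p = \int[mu]_x (K (g' x) `^ p)%R%:E.
      transitivity (\int[mu]_x (`|K (g' x)| `^ p)%R%:E); first exact: poweR_Lnorm_powR.
      by apply: eq_integral => x _; rewrite (ger0_norm (Kge0 _)).
    have e3 : a%:E `^ p = A%:E by rewrite poweR_EFin -powRrM (mulVf pn0) (powRr1 A0).
    rewrite -e1 -[X in X * _]e3 -(poweRM p a0' (NG v')).
    apply: (le_trans (le_poweR (ltW p0) (mule_ge0 a0' (NG v')) H)).
    by rewrite -e2.
  apply/lee_addgt0Pr => e e0.
  (* Approximating within [e / b] costs [a e / b] on the side of [v] and [C e / b] on the side of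
     the gradient, at most [e] together; the [+ 1] keeps [b] positive. *)
  pose b := (a + C + 1)%R; have b0 : (0 < b)%R := ltr_wpDl (addr_ge0 a0 C0) ltr01.
  have [phi tphi Hphi] := dv (e / b)%R (divr_gt0 e0 b0).
  have [sphi _ _] := tphi.
  have mphi := rV_continuous_measurable (smooth_continuous sphi).
  pose w := ((v \- phi) \_ Omega)%R.
  pose z i := (fun x => (g x - grad phi x) ord0 i)%R \_ Omega.
  have wE : w = (v' \- phi)%R.
    apply/funext => x; have pE : phi x = (phi \_ Omega) x by rewrite test_fun_restrict.
    rewrite /= [in RHS]pE /w /v' !patchE; case: ifP => _; first exact: erefl.
    by rewrite subrr.
  have zE i : z i = (fun x => g' x ord0 i - partial i phi x)%R.
    apply/funext => x.
    have pE : partial i phi x = (partial i phi \_ Omega) x.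
      by rewrite (test_fun_restrict (test_fun_partial i tphi)).
    have gE := congr1 (fun f => f x) (g'E i); rewrite /= in gE.
    rewrite gE pE /z !patchE; case: ifP => _; first by rewrite !mxE.
    by rewrite subrr.
  have mz i : measurable_fun setT (z i).
    by rewrite zE; exact: (measurable_funB (mg i) (measurable_grad i tphi)).
  have mw : measurable_fun setT w by rewrite wE; exact: measurable_funB.
  have {}Hphi : N w + \sum_i N (z i) < (e / b)%:E by [].
  have S0 : 0 <= \sum_i N (z i) by apply: sume_ge0 => i _; exact: NG.
  have Hw : N w <= (e / b)%:E.
    by apply: ltW; apply: le_lt_trans Hphi; exact: (leeDl _ S0).
  have Hz : \sum_i N (z i) <= (e / b)%:E.
    by apply: ltW; apply: le_lt_trans Hphi; exact: (leeDr _ (NG w)).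
  have h1 : N v' <= N phi + N w.
    rewrite (_ : v' = (phi \+ w)%R); last first.
      by rewrite wE; apply/funext => x /=; rewrite addrCA subrr addr0.
    exact: minkowski_EFin.
  have h2 : a%:E * N phi <= N (fun x => K (grad phi x)).
    have e1 : N phi = (\int[mu]_x (`|phi x| `^ p)%R%:E) `^ p^-1 := Lnorm_powR mu p phi.
    have e2 : N (fun x => K (grad phi x)) = (\int[mu]_x (K (grad phi x) `^ p)%R%:E) `^ p^-1.
      transitivity ((\int[mu]_x (`|K (grad phi x)| `^ p)%R%:E) `^ p^-1); first exact: Lnorm_powR.
      by congr (_ `^ _); apply: eq_integral => x _; rewrite (ger0_norm (Kge0 _)).
    have ea : a%:E = A%:E `^ p^-1 by [].
    have I1 : 0 <= \int[mu]_x (`|phi x| `^ p)%R%:E.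
      by apply: integral_ge0 => x _; rewrite lee_fin powR_ge0.
    have A0' : 0 <= A%:E by rewrite lee_fin.
    have pV : (0 <= p^-1)%R by rewrite invr_ge0 ltW.
    rewrite e1 e2 ea -(poweRM p^-1 A0' I1).
    by apply: (le_poweR pV (mule_ge0 A0' I1)); exact: hA.
  (* The triangle inequality for [K] and [seminorm_bound] give
     [K (grad phi) <= K g' + C \sum_i |z i|] pointwise; Minkowski's inequality then bounds the
     norms. *)
  have h3 : N (fun x => K (grad phi x)) <= N (fun x => K (g' x)) + C%:E * \sum_i N (z i).
    pose s x := (\sum_i `|z i x|)%R.
    have ms : measurable_fun setT s.
      by apply: measurable_sum => i; exact: measurableT_comp.
    apply: (@le_trans _ _ (N ((fun x => K (g' x)) \+ (fun x => C * s x))%R)).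
      apply: (@le_Lnorm _ _ R mu p (fun x => K (grad phi x))
                ((fun x => K (g' x)) \+ (fun x => C * s x))%R p0).
      - exact: measurable_K_grad.
      - exact: measurable_funD mK (measurable_funM (measurable_cst _) ms).
      - move=> x; have s0 : (0 <= s x)%R by exact: sumr_ge0.
        rewrite /= (ger0_norm (Kge0 _)) (ger0_norm (addr_ge0 (Kge0 _) (mulr_ge0 C0 s0))).
        have [_ KD KZ] := sK.
        rewrite (_ : grad phi x = g' x + (grad phi x - g' x))%R; last first.
          by rewrite addrCA subrr addr0.
        apply: (le_trans (KD _ _)); rewrite lerD2l.
        apply: (le_trans (KC _)); apply: (ler_wpM2l C0).
        by apply: ler_sum => i _; rewrite zE !mxE distrC.
    have mCs := measurable_funM (measurable_cst C) ms.
    apply: (le_trans (minkowski_EFin mu mK mCs p1)).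
    have Es : 'N[mu]_p%:E[EFin \o (fun x => C * s x)%R] = C%:E * N s by exact: Lnorm_scale.
    apply: leeD2l; rewrite Es; apply: lee_wpmul2l; first by rewrite lee_fin.
    have mzn i : measurable_fun setT (fun x => `|z i x|)%R by exact: measurableT_comp.
    apply: (le_trans (Lnorm_sum mu _ p1 mzn)).
    apply: lee_sum => i _; 
    apply: (@le_Lnorm _ _ R mu p (fun x => `|z i x|)%R (z i) p0 (mzn i) (mz i)) => x.
    by rewrite normr_id.
  apply: (@le_trans _ _ (a%:E * (N phi + N w))); first by apply: lee_wpmul2l.
  rewrite (ge0_muleDr _ (NG phi) (NG w)).
  apply: (@le_trans _ _ (N (fun x => K (g' x)) + C%:E * (e / b)%:E + a%:E * (e / b)%:E)).
    apply: leeD; last by apply: lee_wpmul2l.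
    apply: (le_trans h2); apply: (le_trans h3); apply: leeD2l.
    by apply: lee_wpmul2l => //; rewrite lee_fin.
  rewrite -addeA; apply: leeD2l; rewrite -!EFinM -EFinD lee_fin -mulrDl mulrA.
  rewrite (ler_pdivrMr _ _ b0) mulrC; apply: (ler_wpM2l (ltW e0)).
  by rewrite /b (addrC C a) lerDl ler01.
have fI : (0 < fine (\int[mu]_x (`|v' x| `^ p)%R%:E))%R.
  by apply: fine_gt0; rewrite lt0e In0 I0 -(ge0_fin_numE I0) Ifin.
rewrite /rayleigh_quotient num den -(fineK Ifin) inver (gt_eqF fI).
by rewrite (lee_pdivlMr _ _ fI) (fineK Ifin).
Qed.

End rayleigh.

(** * The one-dimensional Poincare inequality *)

Section powR_inequalities.
Context {R : realType}.

(** Normalise by [a + b]: for [u] in [[0, 1]] one has [u^r <= u], and the fractions [a / (a + b)]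
    and [b / (a + b)] add up to [1]. *)
Lemma powR_superadditive (a b r : R) : 0 <= a -> 0 <= b -> 1 <= r ->
  a `^ r + b `^ r <= (a + b) `^ r.
Proof.
move=> a0 b0 r1; have r0 : 0 < r by exact: lt_le_trans r1.
have [ab|s0] := leP (a + b) 0.
  have [-> ->] : a = 0 /\ b = 0 by split; lra.
  by rewrite addr0 powR0 ?gt_eqF// addr0.
have H c : 0 <= c <= a + b -> c `^ r <= (a + b) `^ r * (c / (a + b)).
  move=> /andP[c0 cab]; set u := c / (a + b).
  have u0 : 0 <= u by rewrite divr_ge0// ltW.
  have u1 : u <= 1 by rewrite ler_pdivrMr// mul1r.
  have -> : c = (a + b) * u by rewrite mulrC divfK// gt_eqF.
  rewrite powRM//; last exact: ltW.
  apply: ler_wpM2l; first exact: powR_ge0.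
  have [->|un0] := eqVneq u 0; first by rewrite powR0// gt_eqF.
  by apply: ge1r_powR => //; rewrite lt0r un0 u0.
apply: (le_trans (lerD (H a _) (H b _))); [lra|lra|].
by rewrite -mulrDr -mulrDl divff ?gt_eqF// mulr1.
Qed.

(** Superadditivity with exponent [1 / r], applied to [a^r] and [b^r], and raised to the power
    [r]. *)
Lemma powR_subadditive (a b r : R) : 0 <= a -> 0 <= b -> 0 < r <= 1 ->
  (a + b) `^ r <= a `^ r + b `^ r.
Proof.
move=> a0 b0 /andP[r0 r1].
have ri : 1 <= r^-1 by rewrite invf_ge1.
have := powR_superadditive (powR_ge0 a r) (powR_ge0 b r) ri.
rewrite -!powRrM divff ?gt_eqF// !powRr1// => H.
rewrite -[leRHS]powRr1 ?addr_ge0 ?powR_ge0// -(mulVf (lt0r_neq0 r0)) powRrM.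
apply: ge0_ler_powR => //; rewrite ?nnegrE ?addr_ge0 ?powR_ge0//; exact: ltW.
Qed.

End powR_inequalities.

Section poincare.
Context {R : realType}.
Local Open Scope ereal_scope.

(** Hoelder's inequality for [h] against the indicator of [[-M, M]], with conjugate exponent
    [p / (p - 1)], raised to the power [p]. *)
Lemma hoelder_itv (h : R -> R) (M p : R) : (0 < M)%R -> (1 < p)%R ->
  measurable_fun setT h ->
  (\int[lebesgue_measure]_(t in `[(- M)%R, M]) `|h t|%R%:E) `^ p <=
  ((M *+ 2) `^ (p - 1))%R%:E * \int[lebesgue_measure]_t (`|h t| `^ p)%R%:E.
Proof.
move=> M0 p1 mh; have p0 : (0 < p)%R by exact: lt_trans p1.
pose D : set R := `[(- M)%R, M]%classic.
have mD : measurable D by exact: measurable_itv.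
have lD : lebesgue_measure D = (M *+ 2)%:E.
  rewrite /D lebesgue_measure_itv /= lte_fin ifT; last lra.
  by rewrite -EFinB; congr EFin; ring.
pose q := (p / (p - 1))%R.
have q0 : (0 < q)%R by rewrite divr_gt0// subr_gt0.
have pq : (p^-1 + q^-1 = 1)%R by rewrite /q invf_div; field; rewrite gt_eqF.
have mI : measurable_fun setT (\1_D : R -> R) by exact: measurable_indic.
have := hoelder lebesgue_measure mh mI p0 q0 pq.
set I := \int[_]_(t in _) _; set J := \int[_]_t _.
have -> : 'N[lebesgue_measure]_1[EFin \o (h \* \1_D)%R] = I.
  rewrite Lnorm1 /I [RHS]integral_mkcond; apply: eq_integral => t _.
  rewrite patchE /= indicE.
  by case: (t \in D); rewrite ?mulr1 ?mulr0 ?normr0.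
have -> : 'N[lebesgue_measure]_p%:E[EFin \o h] = J `^ p^-1 by exact: Lnorm_powR.
have -> : 'N[lebesgue_measure]_q%:E[EFin \o \1_D] = (M *+ 2)%:E `^ q^-1.
  rewrite Lnorm_powR; congr (_ `^ _).
  rewrite -lD -[in RHS](setIT D) -integral_indic//; apply: eq_integral => t _.
  by rewrite indicE; case: (t \in D); rewrite ?normr1 ?powR1// normr0 powR0// gt_eqF.
have J0 : 0 <= J by apply: integral_ge0 => t _; rewrite lee_fin powR_ge0.
have I0 : 0 <= I by apply: integral_ge0 => t _; rewrite lee_fin.
move=> /(le_poweR (ltW p0) I0) /le_trans; apply.
rewrite poweRM ?poweR_ge0// -!poweRrM mulVf ?gt_eqF// poweRe1// muleC.
rewrite poweR_EFin (_ : q^-1 * p = p - 1)%R//.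
by rewrite /q invf_div mulrVK// unitfE gt_eqF.
Qed.

(** Since [h] vanishes at [-M], it is the integral of [h'] from [-M]; [hoelder_itv] then gives
    [|h t|^p <= (2 M)^(p-1) J] on the interval, and integrating in [t] supplies the last factor
    [2 M]. *)
Lemma poincare1 (h h' : R -> R) (M p : R) : (0 < M)%R -> (1 < p)%R ->
  (forall t, is_derive t (1%R : R) h (h' t)) -> continuous h' ->
  (forall t, h t != 0 -> `|t| < M)%R ->
  \int[lebesgue_measure]_t (`|h t| `^ p)%R%:E <=
  ((M *+ 2) `^ p)%R%:E * \int[lebesgue_measure]_t (`|h' t| `^ p)%R%:E.
Proof.
move=> M0 p1 dh ch' hM; have p0 : (0 < p)%R by exact: lt_trans p1.
have ch : continuous h.
  move=> t; apply: differentiable_continuous; apply/derivable1_diffP.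
  by case: (dh t).
have mh := continuous_measurable_fun ch.
have mh' := continuous_measurable_fun ch'.
pose D : set R := `[(- M)%R, M]%classic.
have mD : measurable D by exact: measurable_itv.
have lD : lebesgue_measure D = (M *+ 2)%:E.
  rewrite /D lebesgue_measure_itv /= lte_fin ifT; last lra.
  by rewrite -EFinB; congr EFin; ring.
have h0 t : (M <= `|t| -> h t = 0)%R.
  by move=> Mt; apply/eqP; apply: contraTT Mt => /hM; rewrite -ltNge.
set J := (X in _ * X).
have J0 : 0 <= J by apply: integral_ge0 => t _; rewrite lee_fin powR_ge0.
have hb t : (`|h t| `^ p)%R%:E <= ((M *+ 2) `^ (p - 1))%R%:E * J * (\1_D t)%:E.
  have [/eqP ht|ht] := boolP (h t == 0)%R.
    rewrite ht normr0 powR0 ?gt_eqF//; apply: mule_ge0; last by rewrite lee_fin.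
    by apply: mule_ge0 => //; rewrite lee_fin powR_ge0.
  have := hM _ ht; rewrite ltr_norml => /andP[Mt tM].
  rewrite indicE mem_set ?mule1; last by rewrite /D /= in_itv /= !ltW.
  apply: le_trans (hoelder_itv M0 p1 mh').
  rewrite -poweR_EFin; apply: le_poweR; [exact: ltW | by rewrite lee_fin|].
  have hM0 : h (- M)%R = 0%R by apply: h0; rewrite normrN gtr0_norm.
  have := ftc_is_derive Mt dh ch'; rewrite hM0 subr0 => E.
  have mh'2 : measurable_fun `[(- M)%R, t] (EFin \o h').
    by apply/measurable_EFinP; exact: measurable_funTS.
  have -> : `|h t|%R%:E = `|\int[lebesgue_measure]_(t in `[(- M)%R, t]) (h' t)%:E|.
    by rewrite E.
  apply: (@le_trans _ _ (\int[lebesgue_measure]_(s in `[(- M)%R, t]) `|(h' s)%:E|)).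
    exact: le_abse_integral.
  apply: ge0_subset_integral => //.
    apply/measurable_EFinP/measurableT_comp => //; exact: measurable_funTS.
  move=> s /=; rewrite !in_itv /= => /andP[-> st]; exact: le_trans st (ltW tM).
have mI : measurable_fun setT (fun t : R => (\1_D t : R)%:E).
  by apply/measurable_EFinP; exact: measurable_indic.
apply: (@le_trans _ _ (\int[lebesgue_measure]_t (((M *+ 2) `^ (p - 1))%R%:E * J * (\1_D t)%:E))).
  apply: ge0_le_integral => //.
  - exact: measurable_powR_norm.
  - by apply: emeasurable_funM => //; exact: mI.
rewrite ge0_integralZl//; last first.
  by apply: mule_ge0 => //; rewrite lee_fin powR_ge0.
have I1 : \int[lebesgue_measure]_t (\1_D t)%:E = (M *+ 2)%:E.
  by rewrite integral_indic// setIT; exact: lD.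
apply: (@le_trans _ _ (((M *+ 2) `^ (p - 1))%R%:E * J * (M *+ 2)%:E)); first by rewrite -I1.
rewrite muleAC; apply: lee_wpmul2r => //.
rewrite -EFinM lee_fin mulrC mulr_powRB1//.
by rewrite mulrn_wge0// ltW.
Qed.

(** The one-dimensional inequality on each line parallel to the first axis, integrated over the
    other coordinates; only the width of the support along that axis enters. *)
Lemma poincare_rV n (phi : 'rV[R]_n.+1 -> R) (M p : R) : (0 < M)%R -> (1 < p)%R ->
  smooth phi -> (forall x, phi x != 0 -> `|x ord0 ord0| < M)%R ->
  \int[lebesgue_rV n.+1]_x (`|phi x| `^ p)%R%:E <=
  ((M *+ 2) `^ p)%R%:E * \int[lebesgue_rV n.+1]_x (`|partial ord0 phi x| `^ p)%R%:E.
Proof.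
move=> M0 p1 sphi phiM.
have mphi := rV_continuous_measurable (smooth_continuous sphi).
have sd := smooth_partial ord0 sphi.
have md := rV_continuous_measurable (smooth_continuous sd).
have mF (f : 'rV[R]_n.+1 -> R) : measurable_fun setT f ->
    measurable_fun setT (fun v => \int[lebesgue_measure]_t (`|f (cons_rV (t, v))| `^ p)%R%:E).
  move=> mf; apply: (measurable_fun_fubini_tonelli_G (fun z => (`|f (cons_rV z)| `^ p)%R%:E)) => //.
  apply: (@measurableT_comp _ _ _ _ _ _ (fun x => (`|f x| `^ p)%R%:E)).
    exact: measurable_powR_norm.
  exact: measurable_cons_rV.
have F0 (f : 'rV[R]_n.+1 -> R) v : 0 <= \int[lebesgue_measure]_t (`|f (cons_rV (t, v))| `^ p)%R%:E.
  by apply: integral_ge0 => t _; rewrite lee_fin powR_ge0.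
rewrite ge0_integral_rVS_swap; last 2 first.
- exact: measurable_powR_norm.
- by move=> x; rewrite lee_fin powR_ge0.
rewrite [in leRHS]ge0_integral_rVS_swap; last 2 first.
- exact: measurable_powR_norm.
- by move=> x; rewrite lee_fin powR_ge0.
rewrite -ge0_integralZl_EFin//; last 2 first.
- exact: mF.
- exact: powR_ge0.
apply: ge0_le_integral => //.
- exact: mF.
- by apply: emeasurable_funM => //; exact: mF.
move=> v _; apply: poincare1 => //.
- by move=> t; exact: is_derive_cons_rV.
- move=> t; apply: (continuous_comp (@continuous_cons_rV1 R n v t)).
  exact: smooth_continuous sd _.
- by move=> t /phiM; rewrite /cons_rV mxE unlift_none.
Qed.

End poincare.

(** * Splitting row vectors into two blocks *)

Section row_mx_calculus.
Context {R : realType} {m k : nat}.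

Lemma rsubmx_continuous : continuous (@rsubmx R 1 m k).
Proof.
by apply: rV_continuous => i; under eq_fun do rewrite mxE; exact: coord_continuous.
Qed.

Lemma row_mx_continuous (x : 'rV[R]_m) : continuous (fun y : 'rV[R]_k => row_mx x y).
Proof.
apply: rV_continuous => i; under eq_fun do rewrite mxE.
case: (fintype.split i) => j; [exact: cst_continuous | exact: coord_continuous].
Qed.

Lemma lsubmx_delta_lshift (h : R) (z : 'rV[R]_(m + k)) i :
  lsubmx (h *: delta_mx ord0 (lshift k i) + z) = h *: delta_mx ord0 i + lsubmx z.
Proof. by apply/rowP => j; rewrite !mxE (inj_eq (@lshift_inj _ _)). Qed.

Lemma lsubmx_delta_rshift (h : R) (z : 'rV[R]_(m + k)) i :
  lsubmx (h *: delta_mx ord0 (rshift m i) + z) = lsubmx z.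
Proof. by apply/rowP => j; rewrite !mxE eq_lrshift andbF mulr0 add0r. Qed.

Lemma rsubmx_delta_lshift (h : R) (z : 'rV[R]_(m + k)) i :
  rsubmx (h *: delta_mx ord0 (lshift k i) + z) = rsubmx z.
Proof. by apply/rowP => j; rewrite !mxE eq_rlshift andbF mulr0 add0r. Qed.

Lemma rsubmx_delta_rshift (h : R) (z : 'rV[R]_(m + k)) i :
  rsubmx (h *: delta_mx ord0 (rshift m i) + z) = h *: delta_mx ord0 i + rsubmx z.
Proof. by apply/rowP => j; rewrite !mxE (inj_eq (@rshift_inj _ _)). Qed.

Lemma row_mx_delta (h : R) (x : 'rV[R]_m) (y : 'rV[R]_k) i :
  row_mx x (h *: delta_mx ord0 i + y) =
  h *: delta_mx ord0 (rshift m i) + row_mx x y.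
Proof.
apply/rowP => j; have [a ->|a ->] := split_ordP j; rewrite [RHS]mxE.
  by rewrite !row_mxEl !mxE eq_lrshift andbF mulr0 add0r.
by rewrite !row_mxEr !mxE (inj_eq (@rshift_inj _ _)).
Qed.

Lemma coordinatewise_row_mx (x : 'rV[R]_m) : coordinatewise (fun y : 'rV[R]_k => row_mx x y).
Proof.
by move=> i; left; exists 1, (rshift m i) => h y; rewrite mulr1 row_mx_delta.
Qed.

Lemma coordinatewise_lsubmx (c : R) :
  coordinatewise (fun z : 'rV[R]_(m + k) => c *: lsubmx z).
Proof.
move=> i; rewrite -[i]splitK; case: (fintype.split i) => a /=.
  left; exists c, a => h z.
  by rewrite lsubmx_delta_lshift scalerDr scalerA mulrC.
by right=> h z; rewrite lsubmx_delta_rshift.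
Qed.

Lemma coordinatewise_rsubmx : coordinatewise (@rsubmx R 1 m k).
Proof.
move=> i; rewrite -[i]splitK; case: (fintype.split i) => a /=.
  by right=> h z; rewrite rsubmx_delta_lshift.
by left; exists 1, a => h z; rewrite mulr1 rsubmx_delta_rshift.
Qed.

Lemma ge0_integral_tensor (f : 'rV[R]_m -> R) (g : 'rV[R]_k -> R) :
  measurable_fun setT f -> measurable_fun setT g ->
  (forall x, 0 <= f x) -> (forall y, 0 <= g y) ->
  (\int[lebesgue_rV (m + k)]_z (f (lsubmx z) * g (rsubmx z))%:E =
   \int[lebesgue_rV m]_x (f x)%:E * \int[lebesgue_rV k]_y (g y)%:E)%E.
Proof.
move=> mf mg f0 g0.
have ml : measurable_fun setT (@lsubmx R 1 m k).
  apply: measurable_fun_rV => i; under eq_fun do rewrite mxE.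
  exact: measurable_coord.
have mr : measurable_fun setT (@rsubmx R 1 m k).
  apply: measurable_fun_rV => i; under eq_fun do rewrite mxE.
  exact: measurable_coord.
rewrite ge0_integral_row_mx; last 2 first.
- by apply/measurable_EFinP; apply: measurable_funM; exact: measurableT_comp.
- by move=> z; rewrite lee_fin mulr_ge0.
under eq_integral => x _.
  under eq_integral do rewrite row_mxKl row_mxKr EFinM.
  rewrite ge0_integralZl_EFin//; last 2 first.
  - by move=> y _; rewrite lee_fin.
  - by apply/measurable_EFinP.
  over.
rewrite ge0_integralZr//.
- by apply/measurable_EFinP.
- by move=> x _; rewrite lee_fin.
- by apply: integral_ge0 => y _; rewrite lee_fin.
Qed.

End row_mx_calculus.

(** * Cylinders *)

Section euclidean_norm.
Context {R : realType} {n : nat}.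
Implicit Types x : 'rV[R]_n.

Lemma enorm0 : enorm (0 : 'rV[R]_n) = 0.
Proof. by rewrite /enorm /dotp big1 ?sqrtr0// => i _; rewrite mxE mul0r. Qed.

Lemma coord_le_enorm x i : `|x ord0 i| <= enorm x.
Proof.
rewrite -sqrtr_sqr; apply: ler_wsqrtr; rewrite /dotp (bigD1 i)//= -expr2 lerDl.
by apply: sumr_ge0 => j _; rewrite -expr2 sqr_ge0.
Qed.

Lemma enorm_le_sum x : enorm x <= \sum_i `|x ord0 i|.
Proof.
have s0 : 0 <= \sum_i `|x ord0 i| by exact: sumr_ge0.
rewrite -[leRHS]ger0_norm// -sqrtr_sqr; apply: ler_wsqrtr.
rewrite expr2 mulr_suml; apply: ler_sum => i _.
rewrite -expr2 -real_normK ?num_real// expr2 ler_wpM2l// (bigD1 i)//= lerDl.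
exact: sumr_ge0.
Qed.

End euclidean_norm.

(** Convexity at the midpoint of [x] and [y], combined with homogeneity, is the triangle
    inequality. *)
Lemma finsler_seminorm (R : realType) n (H : 'rV[R]_n -> R) : finsler H -> seminorm H.
Proof.
move=> [H0 _ Hc HZ _]; split=> // x y.
have i0 : (0 : R) <= 2^-1 by rewrite invr_ge0.
have i1 : (2^-1 : R) <= 1 by rewrite invf_le1 ?ler1n.
have xT z : z \in [set: 'rV[R]_n] by rewrite inE.
have {Hc} : H (2^-1 *: x + (1 - 2^-1) *: y) <= 2^-1 * H x + (1 - 2^-1) * H y.
  exact: (Hc (Itv01 i0 i1) x y (xT x) (xT y)).
rewrite (_ : 1 - 2^-1 = 2^-1 :> R); last by field.
by rewrite -scalerDr HZ ger0_norm// -mulrDr ler_pM2l ?invr_gt0.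
Qed.

Lemma seminorm_row_mx0 (R : realType) m k (K : 'rV[R]_(m + k) -> R) :
  seminorm K -> seminorm (fun y : 'rV[R]_k => K (row_mx 0 y)).
Proof.
move=> [K0 KD KZ]; split=> // [x y|t x].
  by rewrite -[0 in leLHS]addr0 -add_row_mx.
by rewrite -[0 in LHS](scaler0 _ t) -scale_row_mx.
Qed.

Section Htilde_bounds.
Context {R : realType} {m k : nat}.
Variables (p q theta1 theta2 : R) (F : 'rV[R]_m -> R) (G : 'rV[R]_k -> R).
Hypotheses (p0 : 0 < p) (q0 : 0 < q) (theta1_ge0 : 0 <= theta1).
Hypotheses (bF : norm_bounds theta1 theta2 F) (bG : norm_bounds theta1 theta2 G).
Local Notation H := (Htilde q F G).

Let enorm_ge0 n (x : 'rV[R]_n) : 0 <= enorm x.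
Proof. exact: sqrtr_ge0. Qed.

Let F0 x : 0 <= F x.
Proof. by have /andP[+ _] := bF x; apply: le_trans; rewrite mulr_ge0. Qed.

Let G0 x : 0 <= G x.
Proof. by have /andP[+ _] := bG x; apply: le_trans; rewrite mulr_ge0. Qed.

(** The two norm bounds pin [F 0] to [0]. As the gradient [nabla_2 w] is [row_mx 0 (grad w)], the
    numerators defining [mu] are integrals of [G^p]. *)
Lemma Htilde_row_mx0 y : H (row_mx 0 y) = G y.
Proof.
have F00 : F 0 = 0.
  have /andP[] := bF 0; rewrite enorm0 !mulr0 => h1 h2.
  by apply/le_anti; rewrite h1 h2.
rewrite /Htilde row_mxKl row_mxKr F00 powR0 ?gt_eqF// add0r -powRrM.
by rewrite divff ?gt_eqF// powRr1.
Qed.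

Let HpE z : H z `^ p = (F (lsubmx z) `^ q + G (rsubmx z) `^ q) `^ (p / q).
Proof. by rewrite /Htilde -powRrM mulrC. Qed.

Let powqE a : 0 <= a -> (a `^ q) `^ (p / q) = a `^ p.
Proof. by move=> a0; rewrite -powRrM mulrC divfK// gt_eqF. Qed.

(** Superadditivity of [t^(p/q)] at [F^q] and [G^q], then [F >= theta1 |Z_1|], of which one
    coordinate is kept for the Poincare inequality. *)
Lemma Htilde_powR_ge z i : q <= p ->
  (theta1 * `|lsubmx z ord0 i|) `^ p + H (row_mx 0 (rsubmx z)) `^ p <= H z `^ p.
Proof.
move=> qp; have r1 : 1 <= p / q by rewrite ler_pdivlMr// mul1r.
rewrite [leRHS]HpE [X in _ + X `^ _]Htilde_row_mx0.
apply: le_trans (powR_superadditive (powR_ge0 _ _) (powR_ge0 _ _) r1).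
have FL : theta1 * `|lsubmx z ord0 i| <= F (lsubmx z).
  have /andP[h _] := bF (lsubmx z); apply: le_trans h.
  by apply: ler_wpM2l => //; exact: coord_le_enorm.
rewrite !powqE// lerD2r; apply: (ge0_ler_powR (ltW p0)) => //.
- by rewrite nnegrE mulr_ge0.
- by rewrite nnegrE.
Qed.

(** Subadditivity of [t^(p/q)] at [F^q] and [G^q]; the Euclidean norm of the first block is bounded
    by the sum of its coordinates. *)
Lemma Htilde_powR_le z : 0 <= theta2 -> p <= q ->
  H z `^ p <= (theta2 * \sum_i `|lsubmx z ord0 i|) `^ p + H (row_mx 0 (rsubmx z)) `^ p.
Proof.
move=> t2 pq; have r1 : 0 < p / q <= 1.
  by rewrite divr_gt0//= ler_pdivrMr// mul1r.
rewrite [leLHS]HpE [X in _ <= _ + X `^ _]Htilde_row_mx0.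
apply: (le_trans (powR_subadditive (powR_ge0 _ _) (powR_ge0 _ _) r1)).
have FU : F (lsubmx z) <= theta2 * \sum_i `|lsubmx z ord0 i|.
  have /andP[_ h] := bF (lsubmx z); apply: (le_trans h).
  by apply: ler_wpM2l => //; exact: enorm_le_sum.
rewrite !powqE// lerD2r; apply: (ge0_ler_powR (ltW p0)) => //.
- by rewrite nnegrE.
- by rewrite nnegrE mulr_ge0// sumr_ge0.
Qed.

End Htilde_bounds.

(** * The two estimates on cylinders *)

Section cylinders.
Context {R : realType}.
Local Open Scope ereal_scope.

(** It allows arguing with real lower bounds [A] although either side may be [+oo]; for [x = +oo]
    and [y = s] real, [A = s + 1] gives the contradiction. *)
Lemma le_ereal_real (x y : \bar R) : 0 <= y ->
  (forall A : R, (0 <= A)%R -> A%:E <= x -> A%:E <= y) -> x <= y.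
Proof.
move=> y0 h; case: x h => [r h|h|h]; last exact: leNye.
  have [r0|/ltW r0] := leP 0%R r; first exact: h.
  by apply: le_trans y0; rewrite lee_fin.
case: y y0 h => [s s0 h|//|//].
have := h (s + 1)%R; rewrite leey lee_fin => /(_ _ isT).
by rewrite gerDl ler10; apply; rewrite addr_ge0// -lee_fin.
Qed.

Lemma measurable_powR_seminorm n n' (K : 'rV[R]_n' -> R) (g : 'rV[R]_n -> 'rV[R]_n') p :
  seminorm K -> (forall i, measurable_fun setT (fun x => g x ord0 i)) ->
  measurable_fun setT (fun x => (K (g x) `^ p)%R%:E).
Proof.
move=> sK mg; apply/measurable_EFinP.
apply: (@measurableT_comp _ _ _ _ _ _ (fun x : R => x `^ p)%R); first exact: measurable_powR.
exact: measurable_seminorm.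
Qed.

Lemma measurable_partial n (f : 'rV[R]_n -> R) i : smooth f -> measurable_fun setT (partial i f).
Proof.
by move=> sf; apply: rV_continuous_measurable; exact: smooth_continuous (smooth_partial i sf).
Qed.

Lemma rayleigh_inf_ge0 n (Omega : set 'rV[R]_n) p K : (1 <= p)%R -> seminorm K ->
  0 <= rayleigh_inf Omega p K.
Proof.
move=> p1 sK; apply: rayleigh_inf_ge => // phi _.
by rewrite mul0e; apply: integral_ge0 => x _; rewrite lee_fin powR_ge0.
Qed.

(** This holds for every [x]: the support of the slice is read off from the second block of the
    support of [phi], and the slice is zero when [x] lies outside [l omega1]. *)
Lemma test_fun_slice m k (l : R) (omega1 : set 'rV[R]_m) (omega2 : set 'rV[R]_k) phi x :
  test_fun (cylinder l omega1 omega2) phi ->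
  test_fun omega2 (fun y => phi (row_mx x y)).
Proof.
move=> tp; have [sp _ sO] := tp; have [M _ pM] := test_fun_cube tp.
apply: (@test_funI _ _ _ _ ((fun y => row_mx x y) @^-1` closure [set z | phi z != 0%R]) M).
- apply: (smooth_comp _ _ sp); first exact: row_mx_continuous.
  exact: coordinatewise_row_mx.
- apply: preimage_closed; last exact: closed_closure.
  by move=> y _; exact: row_mx_continuous.
- by move=> y /sO[_]; rewrite row_mxKr.
- by move=> y py; exact: subset_closure.
- by move=> y /pM h i; have := h (rshift m i); rewrite row_mxEr.
Qed.

Lemma grad_slice m k (phi : 'rV[R]_(m + k) -> R) x y : smooth phi ->
  grad (fun y => phi (row_mx x y)) y = rsubmx (grad phi (row_mx x y)).
Proof.
move=> sp; apply/rowP => i; rewrite !mxE.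
have := @partial_comp_dir R k (m + k) (fun y => row_mx x y) phi i (rshift m i) 1 y.
by rewrite mul1r; apply => // h; rewrite mulr1 row_mx_delta.
Qed.

Lemma rayleigh_inf_cylinder_ge m k (omega1 : set 'rV[R]_m.+1) (omega2 : set 'rV[R]_k)
    (K : 'rV[R]_(m.+1 + k) -> R) (l M p theta A : R) :
  (1 < p)%R -> (0 < l)%R -> (0 < M)%R -> (0 <= theta)%R -> seminorm K ->
  (forall x, omega1 x -> `|x ord0 ord0| < M)%R ->
  (forall z, (theta * `|lsubmx z ord0 ord0|) `^ p + K (row_mx 0 (rsubmx z)) `^ p <= K z `^ p)%R ->
  (0 <= A)%R -> A%:E <= rayleigh_inf omega2 p (fun y => K (row_mx 0 y)) ->
  ((theta / (M *+ 2)) `^ p / l `^ p + A)%R%:E <= rayleigh_inf (cylinder l omega1 omega2) p K.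
Proof.
move=> p1 l0 M0 t0 sK o1M Kge A0 Ale.
have p0 : (0 < p)%R by exact: lt_trans p1.
have sK2 := seminorm_row_mx0 sK.
have lM0 : (0 < l * M)%R by exact: mulr_gt0.
apply: rayleigh_inf_ge => //; [exact: ltW| | move=> phi tp].
  by rewrite addr_ge0// divr_ge0 ?powR_ge0.
have [sp _ _] := tp.
have mphi := rV_continuous_measurable (smooth_continuous sp).
pose d0 := partial (ord0 : 'I_(m + k).+1) phi.
have e0 : lshift k (ord0 : 'I_m.+1) = (ord0 : 'I_(m + k).+1) by exact: val_inj.
have md0 : measurable_fun setT d0 by exact: measurable_partial.
pose K2 (z : 'rV[R]_(m.+1 + k)) := (K (row_mx 0 (rsubmx (grad phi z))) `^ p)%R.
have mK2 : measurable_fun setT (EFin \o K2).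
  apply: (measurable_powR_seminorm _ sK2) => i.
  by under eq_fun do rewrite !mxE; exact: measurable_partial.
have mK : measurable_fun setT (fun z => (K (grad phi z) `^ p)%R%:E).
  apply: (measurable_powR_seminorm _ sK) => i.
  by under eq_fun do rewrite !mxE; exact: measurable_partial.
set I := \int[_]_x (`|phi x| `^ p)%R%:E.
pose J := \int[lebesgue_rV (m.+1 + k)]_x (`|d0 x| `^ p)%R%:E.
have I0 : 0 <= I by apply: integral_ge0 => x _; rewrite lee_fin powR_ge0.
have J0 : 0 <= J by apply: integral_ge0 => x _; rewrite lee_fin powR_ge0.
(* On the cylinder the first coordinate is [l] times that of a point of [omega1], so the support has
   half-width [l M]. *)
have HP : I <= (((l * M) *+ 2) `^ p)%R%:E * J.
  apply: (@poincare_rV R (m + k)) => // z /(test_fun_support tp)[[y oy yz] _].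
  have -> : z ord0 ord0 = (l * y ord0 ord0)%R.
    by have := congr1 (fun u : 'rV[R]_m.+1 => u ord0 ord0) yz; rewrite !mxE e0 => ->.
  by rewrite normrM gtr0_norm// ltr_pM2l//; exact: o1M.
(* The bound on [omega2], applied to each slice and integrated over [X1]. *)
have HS : A%:E * I <= \int[lebesgue_rV (m.+1 + k)]_z (K2 z)%:E.
  have mp := measurable_powR_norm p mphi.
  have -> : I = \int[lebesgue_rV m.+1]_x \int[lebesgue_rV k]_y (`|phi (row_mx x y)| `^ p)%R%:E.
    by apply: (ge0_integral_row_mx mp) => z; rewrite lee_fin powR_ge0.
  have -> : \int[lebesgue_rV (m.+1 + k)]_z (K2 z)%:E =
      \int[lebesgue_rV m.+1]_x \int[lebesgue_rV k]_y (K2 (row_mx x y))%:E.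
    by apply: (ge0_integral_row_mx mK2) => z; rewrite lee_fin powR_ge0.
  have mF (f : 'rV[R]_(m.+1 + k) -> \bar R) : measurable_fun setT f -> (forall z, 0 <= f z) ->
      measurable_fun setT (fun x : 'rV[R]_m.+1 => \int[lebesgue_rV k]_y f (row_mx x y)).
    move=> mf f0; apply: (measurable_fun_fubini_tonelli_F (fun z => f (row_mx z.1 z.2))) => //.
    by apply: measurableT_comp => //; exact: measurable_row_mx.
  rewrite -ge0_integralZl_EFin//; last 2 first.
  - by move=> x _; apply: integral_ge0 => y _; rewrite lee_fin powR_ge0.
  - by apply: (mF (fun z => (`|phi z| `^ p)%R%:E)) => // z; rewrite lee_fin powR_ge0.
  apply: ge0_le_integral => //.
  - move=> x _; apply: mule_ge0; first by rewrite lee_fin.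
    by apply: integral_ge0 => y _; rewrite lee_fin powR_ge0.
  - apply: emeasurable_funM => //.
    by apply: (mF (fun z => (`|phi z| `^ p)%R%:E)) => // z; rewrite lee_fin powR_ge0.
  - by apply: (mF (fun z => (K2 z)%:E)) => // z; rewrite lee_fin powR_ge0.
  move=> x _.
  have E : \int[lebesgue_rV k]_y (K2 (row_mx x y))%:E =
      \int[lebesgue_rV k]_y (K (row_mx 0 (grad (fun y => phi (row_mx x y)) y)) `^ p)%R%:E.
    by apply: eq_integral => y _; rewrite (grad_slice x y sp).
  by rewrite E; exact: (rayleigh_inf_le (ltW p1) sK2 A0 Ale (test_fun_slice x tp)).
have c0 : 0 <= ((theta / (M *+ 2)) `^ p / l `^ p)%R%:E by rewrite lee_fin divr_ge0 ?powR_ge0.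
have A0' : 0 <= A%:E by rewrite lee_fin.
rewrite EFinD (ge0_muleDl _ c0 A0').
apply: (@le_trans _ _ ((theta `^ p)%R%:E * J + \int[lebesgue_rV (m.+1 + k)]_z (K2 z)%:E)).
  apply: leeD; last exact: HS.
  apply: (@le_trans _ _ (((theta / (M *+ 2)) `^ p / l `^ p)%R%:E *
      ((((l * M) *+ 2) `^ p)%R%:E * J))).
    exact: lee_wpmul2l.
  rewrite muleA -EFinM.
  (* The Poincare constant [(2 l M)^p] cancels both [(2 M)^p] and [l^p]. *)
  rewrite (_ : (theta / (M *+ 2)) `^ p / l `^ p * ((l * M) *+ 2) `^ p = theta `^ p)%R//.
  have M20 : (0 < M *+ 2)%R by rewrite mulrn_wgt0.
  have lp0 : (0 < l `^ p)%R by exact: powR_gt0.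
  rewrite -mulrnAr (powRM p (ltW l0) (ltW M20)) -mulrA mulKf ?gt_eqF//.
  by rewrite -powRM ?divr_ge0 ?(ltW M20)// divfK// gt_eqF.
have -> : (theta `^ p)%R%:E * J =
    \int[lebesgue_rV (m.+1 + k)]_z ((theta `^ p)%R%:E * (`|d0 z| `^ p)%R%:E).
  apply/esym/ge0_integralZl_EFin => //.
  - exact: measurable_powR_norm.
  - exact: powR_ge0.
have f0 z : 0 <= (theta `^ p)%R%:E * (`|d0 z| `^ p)%R%:E.
  by rewrite -EFinM lee_fin mulr_ge0 ?powR_ge0.
have mf : measurable_fun setT (fun z => (theta `^ p)%R%:E * (`|d0 z| `^ p)%R%:E).
  by apply: emeasurable_funM => //; exact: measurable_powR_norm.
have K20 z : 0 <= (K2 z)%:E by rewrite lee_fin powR_ge0.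
have -> : \int[lebesgue_rV (m.+1 + k)]_z ((theta `^ p)%R%:E * (`|d0 z| `^ p)%R%:E) +
    \int[lebesgue_rV (m.+1 + k)]_z (K2 z)%:E =
    \int[lebesgue_rV (m.+1 + k)]_z ((theta `^ p)%R%:E * (`|d0 z| `^ p)%R%:E + (K2 z)%:E).
  exact/esym/(ge0_integralD _ measurableT (fun z _ => f0 z) mf (fun z _ => K20 z) mK2).
apply: ge0_le_integral.
- exact: measurableT.
- by move=> z _; exact: adde_ge0.
- exact: emeasurable_funD.
- exact: mK.
move=> z _; rewrite -EFinM -EFinD lee_fin; apply: le_trans (Kge (grad phi z)).
by rewrite lerD2r -powRM// !mxE e0.
Qed.

(** For [psi = rho(X1 / l) phi(X2)] the integrals separate, with [a] the mass of [rho] and [b] a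
    bound on its gradient. Only the derivatives in [X1] carry a factor [1 / l], which yields the
    error [theta^p b / a / l^p]. *)
Lemma rayleigh_inf_cylinder_le m k (omega1 : set 'rV[R]_m) (omega2 : set 'rV[R]_k)
    (K : 'rV[R]_(m + k) -> R) (l p theta A B a b : R) (rho : 'rV[R]_m -> R) :
  (1 <= p)%R -> (0 < l)%R -> (0 <= theta)%R -> seminorm K ->
  (forall z, K z `^ p <=
    (theta * \sum_i `|lsubmx z ord0 i|) `^ p + K (row_mx 0 (rsubmx z)) `^ p)%R ->
  test_fun omega1 rho -> (0 < a)%R ->
  \int[lebesgue_rV m]_x (`|rho x| `^ p)%R%:E = a%:E ->
  \int[lebesgue_rV m]_x ((\sum_i `|partial i rho x|) `^ p)%R%:E <= b%:E ->
  (0 <= A)%R -> A%:E <= rayleigh_inf (cylinder l omega1 omega2) p K ->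
  (0 <= B)%R -> (B + theta `^ p * b / a / l `^ p <= A)%R ->
  B%:E <= rayleigh_inf omega2 p (fun y => K (row_mx 0 y)).
Proof.
move=> p1 l0 t0 sK Kle tr a0 Ia Ib A0 Ale B0 AB.
have p0 : (0 < p)%R by exact: lt_le_trans p1.
have sK2 := seminorm_row_mx0 sK; have [K0 KD KZ] := sK.
apply: rayleigh_inf_ge => // phi tp.
have [sr _ rO] := tr; have [sp _ pO] := tp.
have [Mr Mr0 rM] := test_fun_cube tr; have [Mp Mp0 pM] := test_fun_cube tp.
pose rl (z : 'rV[R]_(m + k)) := rho (l^-1 *: lsubmx z)%R.
pose ph (z : 'rV[R]_(m + k)) := phi (rsubmx z).
pose psi z := (rl z * ph z)%R.
have cL : continuous (fun z : 'rV[R]_(m + k) => l^-1 *: lsubmx z)%R.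
  apply: rV_continuous => i; under eq_fun do rewrite !mxE.
  move=> z; apply: (@continuousM _ _ (fun=> l^-1)%R
    (fun z : 'rV[R]_(m + k) => z ord0 (lshift k i))).
    exact: cst_continuous.
  exact: coord_continuous.
have srl : smooth rl by exact: (smooth_comp cL (coordinatewise_lsubmx l^-1) sr).
have sph : smooth ph by exact: (smooth_comp rsubmx_continuous coordinatewise_rsubmx sp).
have tpsi : test_fun (cylinder l omega1 omega2) psi.
  have nz z : psi z != 0%R -> rho (l^-1 *: lsubmx z)%R != 0%R /\ phi (rsubmx z) != 0%R.
    by rewrite mulf_eq0 negb_or => /andP[].
  apply: (@test_funI _ _ _ _
    ((fun z : 'rV[R]_(m + k) => l^-1 *: lsubmx z)%R @^-1` closure [set x | rho x != 0%R] `&`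
     @rsubmx R 1 m k @^-1` closure [set y | phi y != 0%R]) (Num.max (l * Mr)%R Mp)).
  - exact: smoothM.
  - apply: closedI; (apply: preimage_closed; last exact: closed_closure) => z _.
      exact: cL.
    exact: rsubmx_continuous.
  - move=> z [/rO oz /pO pz]; split=> //; exists (l^-1 *: lsubmx z)%R => //.
    by rewrite scalerA divff ?gt_eqF// scale1r.
  - by move=> z /nz[rz pz]; split; exact: subset_closure.
  - move=> z /nz[/rM rz /pM pz] i; have [j ->|j ->] := split_ordP i.
      have := rz j; rewrite !mxE normrM gtr0_norm ?invr_gt0// ler_pdivrMl// => h.
      by rewrite (le_trans h)// le_max lexx.
    by have := pz j; rewrite !mxE => h; rewrite (le_trans h)// le_max lexx orbT.
have := rayleigh_inf_le p1 sK A0 Ale tpsi.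
have mr := rV_continuous_measurable (smooth_continuous sr).
have mp := rV_continuous_measurable (smooth_continuous sp).
have mS : measurable_fun setT (fun x : 'rV[R]_m => l^-1 *: x)%R by exact: measurable_scale_rV.
pose fa x := (`|rho x| `^ p)%R; pose fb x := ((\sum_i `|partial i rho x|) `^ p)%R.
pose ga y := (`|phi y| `^ p)%R; pose gb y := (K (row_mx 0 (grad phi y)) `^ p)%R.
have fa0 x : (0 <= fa x)%R by exact: powR_ge0.
have fb0 x : (0 <= fb x)%R by exact: powR_ge0.
have ga0 x : (0 <= ga x)%R by exact: powR_ge0.
have gb0 x : (0 <= gb x)%R by exact: powR_ge0.
have mfa : measurable_fun setT fa by apply/measurable_EFinP; exact: measurable_powR_norm.
have mfb : measurable_fun setT fb.
  apply: (@measurableT_comp _ _ _ _ _ _ (fun x : R => x `^ p)%R); first exact: measurable_powR.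
  by apply: measurable_sum => i; apply: measurableT_comp => //; exact: measurable_partial.
have mga : measurable_fun setT ga by apply/measurable_EFinP; exact: measurable_powR_norm.
have mgb : measurable_fun setT gb.
  apply/measurable_EFinP; apply: (measurable_powR_seminorm _ sK2) => i.
  by under eq_fun do rewrite mxE; exact: measurable_partial.
(* The dilation by [l] brings out the same factor [l^m] in all three integrals; it is cancelled at
   the end. *)
have tens (f : 'rV[R]_m -> R) (g : 'rV[R]_k -> R) :
    measurable_fun setT f -> measurable_fun setT g ->
    (forall x, 0 <= f x)%R -> (forall y, 0 <= g y)%R ->
    \int[lebesgue_rV (m + k)]_z (f (l^-1 *: lsubmx z) * g (rsubmx z))%R%:E =
    (l ^+ m)%:E * \int[lebesgue_rV m]_x (f x)%:E * \int[lebesgue_rV k]_y (g y)%:E.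
  move=> mf mg f0 g0.
  rewrite (@ge0_integral_tensor _ _ _ (fun x => f (l^-1 *: x)%R) g)//.
    rewrite (@ge0_integral_scale _ _ l (EFin \o f))//; first exact/measurable_EFinP.
  exact: measurableT_comp.
have -> : \int[lebesgue_rV (m + k)]_z (`|psi z| `^ p)%R%:E =
    (l ^+ m)%:E * a%:E * \int[lebesgue_rV k]_y (ga y)%:E.
  rewrite -Ia -(tens fa ga)//; apply: eq_integral => z _.
  by rewrite /psi normrM powRM.
(* The blocks of [grad psi] are [phi(X2) / l] times [grad rho] at [X1 / l], and
   [rho(X1 / l) grad phi(X2)]. *)
have Gle z : (K (grad psi z) `^ p <= (theta / l) `^ p * (fb (l^-1 *: lsubmx z) * ga (rsubmx z)) +
    fa (l^-1 *: lsubmx z) * gb (rsubmx z))%R.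
  have dl i : lsubmx (grad psi z) ord0 i = (ph z * (l^-1 * partial i rho (l^-1 *: lsubmx z)))%R.
    rewrite !mxE (partialM _ _ srl sph).
    rewrite (@partial_comp_dir0 _ _ _ (@rsubmx R 1 m k) phi); last first.
      by move=> h; rewrite rsubmx_delta_lshift.
    rewrite mulr0 add0r; congr (_ * _)%R.
    apply: (@partial_comp_dir R _ _ (fun z : 'rV[R]_(m + k) => l^-1 *: lsubmx z)%R) => // h.
    by rewrite lsubmx_delta_lshift scalerDr scalerA mulrC.
  have dr : rsubmx (grad psi z) = (rl z *: grad phi (rsubmx z))%R.
    apply/rowP => j; rewrite !mxE (partialM _ _ srl sph).
    rewrite (@partial_comp_dir0 _ _ _
      (fun z : 'rV[R]_(m + k) => l^-1 *: lsubmx z)%R rho); last first.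
      by move=> h; rewrite lsubmx_delta_rshift.
    rewrite mulr0 addr0; congr (_ * _)%R.
    rewrite -[RHS]mul1r.
    apply: (@partial_comp_dir R _ _ (@rsubmx R 1 m k)) => // h.
    by rewrite mulr1 rsubmx_delta_rshift.
  apply: (le_trans (Kle _)); rewrite dr -[0%R in X in (_ + X <= _)%R](scaler0 _ (rl z)).
  rewrite -scale_row_mx KZ [X in (_ + X <= _)%R]powRM//.
  rewrite lerD2r.
  have -> : (theta * \sum_i `|lsubmx (grad psi z) ord0 i| =
      (theta / l) * ((\sum_i `|partial i rho (l^-1 *: lsubmx z)|) * `|ph z|))%R.
    rewrite -mulrA; congr (_ * _)%R; rewrite mulr_suml mulr_sumr.
    apply: eq_bigr => i _.
    by rewrite dl !normrM (gtr0_norm (_ : 0 < l^-1)%R) ?invr_gt0//; ring.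
  rewrite powRM ?divr_ge0 ?mulr_ge0 ?sumr_ge0 ?(ltW l0)//.
  by rewrite [X in (_ * X <= _)%R]powRM ?sumr_ge0.
have mL : measurable_fun setT (fun z : 'rV[R]_(m + k) => l^-1 *: lsubmx z)%R.
  apply: measurableT_comp => //; apply: measurable_fun_rV => i; under eq_fun do rewrite mxE.
  exact: measurable_coord.
have mR : measurable_fun setT (@rsubmx R 1 m k).
  by apply: measurable_fun_rV => i; under eq_fun do rewrite mxE; exact: measurable_coord.
have mT (f : 'rV[R]_m -> R) (g : 'rV[R]_k -> R) :
    measurable_fun setT f -> measurable_fun setT g ->
    measurable_fun setT (fun z => (f (l^-1 *: lsubmx z) * g (rsubmx z))%R%:E).
  by move=> mf mg; apply/measurable_EFinP; apply: measurable_funM; exact: measurableT_comp.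
set lhs := (X in X <= _ -> _); set Ig := \int[_]_x (`|phi x| `^ p)%R%:E.
set Ih := (X in _ -> _ <= X) => lhsle.
have Ig0 : 0 <= Ig by apply: integral_ge0 => x _; rewrite lee_fin.
have Ih0 : 0 <= Ih by apply: integral_ge0 => x _; rewrite lee_fin powR_ge0.
have tl0 : (0 <= (theta / l) `^ p)%R by exact: powR_ge0.
have {lhsle} : lhs <= ((theta / l) `^ p)%R%:E * ((l ^+ m)%:E * b%:E * Ig) + (l ^+ m)%:E * a%:E * Ih.
  apply: (le_trans lhsle).
  apply: (@le_trans _ _ (\int[lebesgue_rV (m + k)]_z
      (((theta / l) `^ p)%R%:E * (fb (l^-1 *: lsubmx z) * ga (rsubmx z))%R%:E +
      (fa (l^-1 *: lsubmx z) * gb (rsubmx z))%R%:E))).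
    apply: ge0_le_integral => //.
    - by move=> z _; rewrite lee_fin powR_ge0.
    - apply: (measurable_powR_seminorm _ sK) => i; under eq_fun do rewrite mxE.
      by have [spsi _ _] := tpsi; exact: measurable_partial.
    - apply: emeasurable_funD; last exact: mT.
      by apply: emeasurable_funM => //; exact: mT.
    - by move=> z _; rewrite -EFinM -EFinD lee_fin.
  rewrite ge0_integralD//; last 4 first.
  - by move=> z _; rewrite -EFinM lee_fin !mulr_ge0.
  - by apply: emeasurable_funM => //; exact: mT.
  - by move=> z _; rewrite lee_fin mulr_ge0.
  - exact: mT.
  rewrite ge0_integralZl_EFin//; last 2 first.
  - by move=> z _; rewrite lee_fin mulr_ge0.
  - exact: mT.
  rewrite !tens// Ia; apply: leeD2r; apply: lee_wpmul2l; first by rewrite lee_fin.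
  apply: (lee_wpmul2r Ig0).
  by apply: (lee_wpmul2l _ Ib); rewrite lee_fin exprn_ge0// ltW.
have Igf : Ig \is a fin_num.
  rewrite (ge0_fin_numE Ig0); exact: integral_powR_support p0 (smooth_continuous sp) pM.
rewrite /lhs -/Ig -(fineK Igf); set g := fine Ig.
have g0 : (0 <= g)%R by exact: fine_ge0.
case: Ih Ih0 => [h h0|_ _|//]; last by rewrite leey.
rewrite -!EFinM -EFinD !lee_fin => H.
have L0 : (0 < l ^+ m)%R by exact: exprn_gt0.
have {}H : (A * a * g <= theta `^ p / l `^ p * b * g + a * h)%R.
  rewrite -(ler_pM2l L0).
  have <- : ((theta / l) `^ p = theta `^ p / l `^ p)%R.
    by rewrite powRM ?invr_ge0 ?(ltW l0)// -[(l^-1)%R]powR_inv1 ?(ltW l0)// -powRrM mulN1r powRN.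
  by move: H; congr (_ <= _)%R; ring.
(* Together with [H], this cancels the terms in [b] and leaves [a B g <= a h]. *)
have ABa : (B * a + theta `^ p / l `^ p * b <= A * a)%R.
  have := ler_wpM2r (ltW a0) AB.
  rewrite mulrDl (_ : _ / a / l `^ p * a = theta `^ p / l `^ p * b)%R//.
  by rewrite mulrAC divfK ?gt_eqF// mulrAC.
have := ler_wpM2r g0 ABa; rewrite mulrDl => H2.
rewrite -(ler_pM2l a0) mulrA (mulrC a B).
have := le_trans H2 H.
by rewrite [X in (_ <= X)%R -> _]addrC lerD2r.
Qed.

End cylinders.

(** By continuity [f >= f 0 / 2] on a cube around [0], which has positive measure. *)
Lemma integral_powR_gt0 (R : realType) n (f : 'rV[R]_n -> R) (p : R) : 0 < p ->
  continuous f -> 0 < f 0 ->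
  (0 < \int[lebesgue_rV n]_x (`|f x| `^ p)%:E)%E.
Proof.
move=> p0 cf f0.
have f20 : 0 < f 0 / 2 by rewrite divr_gt0.
have [e e0 he] : exists2 e : R, 0 < e & forall x, cube e x -> f 0 / 2 <= f x.
  have /(@cvgrPdist_lt R R^o _ (nbhs (0 : 'rV[R]_n)) _ f (f 0))/(_ _ f20) := cf 0.
  move=> /nbhs_ballP[e /= e0 eP]; exists (e / 2); first by rewrite divr_gt0.
  move=> x xe; have : ball (0 : 'rV[R]_n) e x.
    split=> // i j; rewrite (ord1 i) /ball /= mxE sub0r normrN.
    by apply: (le_lt_trans (xe j)); rewrite ltr_pdivrMr// ltr_pMr// ltr1n.
  by move=> /eP /ltW /=; rewrite ler_norml => /andP[_]; lra.
have mC := @measurable_cube R n e.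
apply: (@lt_le_trans _ _ (\int[lebesgue_rV n]_x (((f 0 / 2) `^ p)%:E * (\1_(@cube R n e) x)%:E)))%E.
  rewrite ge0_integralZl_EFin//; last 2 first.
  - by apply/measurable_EFinP; exact: measurable_indic.
  - exact: powR_ge0.
  rewrite integral_indic// setIT.
  have E := lebesgue_cube n (ltW e0).
  apply: (@lt_le_trans _ _ (((f 0 / 2) `^ p)%:E * ((e *+ 2) ^+ n)%:E)%E); last by rewrite -E.
  by rewrite -EFinM lte_fin mulr_gt0 ?powR_gt0// exprn_gt0// mulrn_wgt0.
apply: ge0_le_integral => //.
- by move=> x _; rewrite -EFinM lee_fin mulr_ge0 ?powR_ge0.
- apply: emeasurable_funM => //.
  by apply/measurable_EFinP; exact: measurable_indic.
- by apply: measurable_powR_norm; exact: rV_continuous_measurable.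
- move=> x _; rewrite -EFinM lee_fin indicE.
  have [/set_mem /he fx|_] := boolP (x \in cube e); last by rewrite mulr0 powR_ge0.
  rewrite mulr1; apply: (ge0_ler_powR (ltW p0)); rewrite ?nnegrE//; first exact: ltW.
  exact: le_trans fx (ler_norm _).
Qed.

(* R^n is R^(m + k), with m and k = n - m both positive. *)
Theorem theorem5p1 (R : realType) (m : nat) (omega1 : set 'rV[R]_m) :
  (0 < m)%N ->
  open omega1 -> bounded_set omega1 -> convex_set omega1 -> omega1 0 ->
  exists C1 C2 : R -> R -> R,
    (forall theta p : R, 0 < theta -> 2 <= p ->
       0 < C1 theta p /\ 0 < C2 theta p) /\
    forall (k : nat) (omega2 : set 'rV[R]_k) (p q c1 theta1 theta2 : R)
           (F : 'rV[R]_m -> R) (G : 'rV[R]_k -> R),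
      (0 < k)%N -> open omega2 -> bounded_set omega2 ->
      2 <= p -> 1 < q ->
      let H := Htilde q F G in
      finsler H ->
      is_minimum (H @` unit_sphere) theta1 ->
      is_maximum (H @` unit_sphere) theta2 ->
      0 < c1 -> strongly_monotone p c1 F -> strongly_monotone p c1 G ->
      norm_bounds theta1 theta2 F -> norm_bounds theta1 theta2 G ->
      forall l : R, 0 < l ->
        let lambda := rayleigh_inf (cylinder l omega1 omega2) p H in
        let mu := rayleigh_inf omega2 p (fun Z2 => H (row_mx 0 Z2)) in
        (q <= p -> ((C1 theta1 p / l `^ p)%:E + mu <= lambda)%E) /\
        (p <= q -> (lambda <= mu + (C2 theta2 p / l `^ p)%:E)%E).
Proof.
case: m omega1 => // m omega1 _ oO bO _ O0.
have [M M0 hM] := bounded_set_cube bO.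
have [rho [tr rho0]] : exists rho, test_fun omega1 rho /\ 0 < rho 0.
  have /nbhs_ballP[e /= e0 eO] := open_nbhs_nbhs (conj oO O0).
  (* Half the radius: the closed cube that contains the support must lie in the open ball. *)
  have e20 : 0 < e / 2 by rewrite divr_gt0.
  have [rho [srho rho0 rhoe]] := @exists_bump R m.+1 _ e20.
  exists rho; split=> //; apply: (@test_funI _ _ _ _ (cube (e / 2)) (e / 2)) => //.
  - exact: closed_cube.
  - move=> x xe; apply: eO; split=> // i j; rewrite (ord1 i) /ball /= mxE sub0r normrN.
    by apply: (le_lt_trans (xe j)); rewrite ltr_pdivrMr// ltr_pMr// ltr1n.
have [srho _ _] := tr; have [Mr _ rM] := test_fun_cube tr.
(* Real-valued integrals, defined for every real [p], because [C1] and [C2] are functions given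
   before [p] is constrained; [aP] and [bP] recover the extended integrals for [p > 0]. *)
pose a p := \int[lebesgue_rV m.+1]_x (`|rho x| `^ p).
pose b p := \int[lebesgue_rV m.+1]_x ((\sum_i `|partial i rho x|) `^ p).
have b0 p : 0 <= b p.
  by apply: fine_ge0; apply: integral_ge0 => x _; rewrite lee_fin powR_ge0.
have aP p : 0 < p -> 0 < a p /\
    (\int[lebesgue_rV m.+1]_x (`|rho x| `^ p)%:E)%E = (a p)%:E.
  move=> p0; have cr := smooth_continuous srho.
  have gt := integral_powR_gt0 p0 cr rho0.
  have lt := integral_powR_support p0 cr rM.
  split; first by apply: fine_gt0; rewrite gt lt.
  by rewrite /a /Rintegral fineK// ge0_fin_numE// ltW.
have bP p : 0 < p ->
    (\int[lebesgue_rV m.+1]_x ((\sum_i `|partial i rho x|) `^ p)%:E)%E = (b p)%:E.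
  move=> p0; rewrite /b /Rintegral fineK// ge0_fin_numE; last first.
    by apply: integral_ge0 => x _; rewrite lee_fin powR_ge0.
  have s0 x : 0 <= \sum_i `|partial i rho x| by exact: sumr_ge0.
  under eq_integral do rewrite -(ger0_norm (s0 _)).
  apply: (@integral_powR_support _ _ _ Mr) => //.
    apply: continuous_big => [|i _ x]; first exact: add_continuous.
    apply: continuous_comp; last exact: norm_continuous.
    exact: smooth_continuous (smooth_partial i srho) _.
  move=> x; apply: contraPP => /= nM; apply/negP; rewrite negbK; apply/eqP.
  apply: big1 => i _; apply/eqP; rewrite normr_eq0; apply/negPn/negP => dx.
  by apply: nM; apply: (partial_support _ rM dx); exact: closed_cube.
exists (fun theta p => (theta / (M *+ 2)) `^ p), (fun theta p => theta `^ p * (b p + 1) / a p).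
split=> [theta p t0 p2|k omega2 p q c1 theta1 theta2 F G _ _ _ p2 q1 H fH min1 max2].
  have p0 : 0 < p by apply: lt_le_trans p2.
  have [a0 _] := aP _ p0.
  split; first by rewrite powR_gt0// divr_gt0// mulrn_wgt0.
  exact: (divr_gt0 (mulr_gt0 (powR_gt0 _ t0) (ltr_wpDl (b0 p) ltr01)) a0).
move=> _ _ _ bF bG l l0 lambda mu.
have p1 : 1 < p by apply: lt_le_trans p2; rewrite ltr1n.
have p0 : 0 < p by apply: lt_le_trans p2.
have q0 : 0 < q by apply: lt_trans q1.
have sH := finsler_seminorm fH.
(* The minimum is attained at a point of the unit sphere, which is nonzero. *)
have theta1_gt0 : 0 < theta1.
  have [[x /= x1 <-] _] := min1; apply: (finsler_gt0 fH).
  by apply/eqP => x0; move: x1; rewrite /unit_sphere /= x0 enorm0 => /esym/eqP; rewrite oner_eq0.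
have theta2_ge0 : 0 <= theta2.
  by have [[x _ <-] _] := max2; exact: (finsler_ge0 fH).
have mu0 : (0 <= mu)%E.
  by apply: rayleigh_inf_ge0; [exact: ltW | exact: seminorm_row_mx0].
have lp0 : 0 < l `^ p by exact: powR_gt0.
have [a0 aE] := aP _ p0.
split=> [qp|pq].
  have lambda0 : (0 <= lambda)%E by apply: rayleigh_inf_ge0; [exact: ltW | exact: sH].
  pose c := (theta1 / (M *+ 2)) `^ p / l `^ p; apply: (le_ereal_real lambda0) => A A0 Ale.
  (* From [A <= c + mu], the real [A - c] is a lower bound for [mu]; it is truncated at [0] because
     the cylinder estimate takes a nonnegative bound. *)
  have B0 : 0 <= Num.max 0 (A - c) by rewrite le_max lexx.
  have Bmu : ((Num.max 0 (A - c))%:E <= mu)%E.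
    rewrite EFin_max ge_max mu0 /= EFinB.
    by rewrite leeBlDl.
  have := @rayleigh_inf_cylinder_ge R m k omega1 omega2 H l M p theta1 _ p1 l0 M0
    (ltW theta1_gt0) sH (fun x ox => hM x ox ord0)
    (fun z => Htilde_powR_ge p0 q0 (ltW theta1_gt0) bF bG z ord0 qp) B0 Bmu.
  by apply: le_trans; rewrite lee_fin -lerBlDl le_max lexx orbT.
pose c := theta2 `^ p * (b p + 1) / a p / l `^ p.
have c0 : 0 <= c.
  by rewrite divr_ge0// ?(ltW lp0)// divr_ge0 ?(ltW a0)// mulr_ge0 ?powR_ge0// addr_ge0.
apply: le_ereal_real => [|A A0 Ale]; first by rewrite adde_ge0.
(* If [A < c] the claim follows from [mu >= 0]; otherwise [A - c] is an admissible bound [B] on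
   [omega2]. *)
have [Ac|/ltW cA] := leP A c.
  by apply: (@le_trans _ _ c%:E); [rewrite lee_fin | exact: (leeDr _ mu0)].
have B0 : 0 <= A - c by rewrite subr_ge0.
have bE : (\int[lebesgue_rV m.+1]_x ((\sum_i `|partial i rho x|) `^ p)%:E <= (b p + 1)%:E)%E.
  by rewrite bP// lee_fin lerDl.
have BcA : A - c + theta2 `^ p * (b p + 1) / a p / l `^ p <= A by rewrite subrK.
have := @rayleigh_inf_cylinder_le R m.+1 k omega1 omega2 H l p theta2 A (A - c) (a p) (b p + 1) rho
  (ltW p1) l0 theta2_ge0 sH
  (fun z => Htilde_powR_le p0 q0 (ltW theta1_gt0) bF bG z theta2_ge0 pq)
  tr a0 aE bE A0 Ale B0 BcA.
by move=> Bmu; rewrite -leeBlDr.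
Qed.
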